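(* For any $w_1\in\mathfrak{h}^1_t$ and $w_0\in\mathfrak{h}^0_t$, we have $$Z^{\sqcup\!\sqcup}_t\big(w_1\overset{t}{\sqcup\!\sqcup} w_0-w_1\overset{t}{\ast} w_0\big)=0,\quad\text{and}\quad Z^{\ast}_t\big(w_1\overset{t}{\sqcup\!\sqcup} w_0-w_1\overset{t}{\ast} w_0\big)=0.$$
   Context: Let $A=\{x,y\}$ be an alphabet of two noncommutative letters, $A^{\ast}$ the set of words (including the empty word $1$), $\mathfrak{h}_t=\mathbb{Q}[t]\langle A\rangle$, $\mathfrak{h}_t^1=\mathbb{Q}[t]+\mathfrak{h}_ty$, $\mathfrak{h}_t^0=\mathbb{Q}[t]+x\mathfrak{h}_ty$, and $z_k=x^{k-1}y$. For an admissible index $\mathbf{k}=(k_1,\ldots,k_n)$ ($k_1\geqslant2$) the interpolated multiple zeta value is $\zeta^t(\mathbf{k})=\sum_{\mathbf{p}}t^{n-\mathrm{dep}(\mathbf{p})}\zeta(\mathbf{p})$, where $\mathbf{p}$ runs over all sequences $(k_1\Box k_2\Box\cdots\Box k_n)$ with each $\Box$ a comma or a plus, and $\zeta$ is the multiple zeta value. $Z_t:\mathfrak{h}_t^0\to\mathbb{R}[t]$ is the $\mathbb{Q}[t]$-linear map with $Z_t(1)=1$, $Z_t(z_{k_1}\cdots z_{k_n})=\zeta^t(k_1,\ldots,k_n)$. The $t$-shuffle product $\overset{t}{\sqcup\!\sqcup}$ on $\mathfrak{h}_t$ is the $\mathbb{Q}[t]$-bilinear product with $1\overset{t}{\sqcup\!\sqcup}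 w=w\overset{t}{\sqcup\!\sqcup} 1=w$ and $aw_1\overset{t}{\sqcup\!\sqcup} bw_2=a(w_1\overset{t}{\sqcup\!\sqcup} bw_2)+b(aw_1\overset{t}{\sqcup\!\sqcup} w_2)-\delta(w_1)\rho(a)bw_2-\delta(w_2)\rho(b)aw_1$ for $w,w_1,w_2\in A^\ast$, $a,b\in A$, where $\delta(w)=1$ if $w=1$ and $0$ otherwise, and $\rho(x)=0$, $\rho(y)=tx$. The $t$-harmonic product $\overset{t}{\ast}$ on $\mathfrak{h}_t^1$ is the $\mathbb{Q}[t]$-bilinear product with $1\overset{t}{\ast} w=w\overset{t}{\ast} 1=w$ and $z_kw_1\overset{t}{\ast} z_lw_2=z_k(w_1\overset{t}{\ast} z_lw_2)+z_l(z_kw_1\overset{t}{\ast} w_2)+(1-2t)z_{k+l}(w_1\overset{t}{\ast} w_2)+(1-\delta(w_1)\delta(w_2))(t^2-t)x^{k+l}(w_1\overset{t}{\ast} w_2)$. Both are commutative and associative, and with respect to either product $\mathfrak{h}_t^1=\mathfrak{h}_t^0[y]$ (polynomial algebra in $y$ over $\mathfrak{h}_t^0$). Hence there are unique algebra homomorphisms $Z_t^{\sqcup\!\sqcup}:(\mathfrak{h}_t^1,\overset{t}{\sqcup\!\sqcup})\to\mathbb{R}[t,T]$ and $Z_t^{\ast}:(\mathfrak{h}_t^1,\overset{t}{\ast})\to\mathbb{R}[t,T]$ with $Z_t^{\sqcup\!\sqcup}|_{\mathfrak{h}_t^0}=Z_t=Z_t^{\ast}|_{\mathfrak{h}_t^0}$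 and $Z_t^{\sqcup\!\sqcup}(y)=Z_t^{\ast}(y)=T$. *)

(* Defs.v *)
From HB Require Import structures.
From mathcomp Require Import all_boot all_order all_algebra.
From mathcomp Require Import finmap.
From mathcomp Require Import multinomials.monalg.
From mathcomp Require Import boolp classical_sets reals topology normedtype.
From mathcomp Require Import sequences.

Set Implicit Arguments.
Unset Strict Implicit.
Unset Printing Implicit Defensive.

Import GRing.Theory Num.Theory numFieldNormedType.Exports.

Local Open Scope ring_scope.

Inductive letter : predArgType := Lx | Ly.

Definition letter_is_y (a : letter) : bool := if a is Ly then true else false.
Definition letter_of_bool (b : bool) : letter := if b then Ly else Lx.

Lemma letter_is_yK : cancel letter_is_y letter_of_bool.
Proof. by case. Qed.

HB.instance Definition _ := Choice.copy letter (can_type letter_is_yK).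

Definition word := seq letter.

(* Multiplication in this ring is concatenation, i.e. this is Q[t]<x, y>;
   the t-shuffle and t-harmonic products are separate operations below. *)
Definition ht : Type := {malg {poly rat}[{fmonom letter}]}.

HB.instance Definition _ := GRing.Lalgebra.on ht.

Definition tvar : {poly rat} := 'X.

Definition mon (w : word) : ht := mkmalgU (FMonom w) 1.

Definition lx : ht := mon [:: Lx].
Definition ly : ht := mon [:: Ly].

Definition in_h1 (f : ht) : Prop :=
  exists (c : {poly rat}) (g : ht), f = c *: 1 + g * ly.

Definition in_h0 (f : ht) : Prop :=
  exists (c : {poly rat}) (g : ht), f = c *: 1 + lx * g * ly.

Definition bilin_ext (F : word -> word -> ht) (f g : ht) : ht :=
  \sum_(u <- msupp f) \sum_(v <- msupp g) (mcoeff u f * mcoeff v g) *: F u v.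

Definition delta (T : Type) (s : seq T) : {poly rat} := (nilp s)%:R.

Definition rho (a : letter) : ht := if a is Ly then tvar *: lx else 0.

Fixpoint tshuffle_word (u : word) : word -> ht :=
  match u with
  | [::] => mon
  | a :: u' =>
    fix aux (v : word) : ht :=
      match v with
      | [::] => mon (a :: u')
      | b :: v' =>
          mon [:: a] * tshuffle_word u' (b :: v')
        + mon [:: b] * aux v'
        - delta u' *: (rho a * mon (b :: v'))
        - delta v' *: (rho b * mon (a :: u'))
      end
  end.

Definition tshuffle : ht -> ht -> ht := bilin_ext tshuffle_word.

Lemma tshuffle_word1w w : tshuffle_word [::] w = mon w.
Proof. by []. Qed.

Lemma tshuffle_wordw1 w : tshuffle_word w [::] = mon w.
Proof. by case: w. Qed.

Lemma tshuffle_word_cons a u b v :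
  tshuffle_word (a :: u) (b :: v) =
    mon [:: a] * tshuffle_word u (b :: v) + mon [:: b] * tshuffle_word (a :: u) v
    - delta u *: (rho a * mon (b :: v)) - delta v *: (rho b * mon (a :: u)).
Proof. by []. Qed.

(* z_k = x^(k-1) y; only meaningful for k >= 1. *)
Definition zletters (k : nat) : word := rcons (nseq k.-1 Lx) Ly.

Definition zword (k : seq nat) : word := flatten (map zletters k).

Definition z_ (k : nat) : ht := mon (zletters k).

(* Inverse of zword on words that are empty or end in y; letters x after the
   last y are dropped, so values on other words are junk. *)
Fixpoint index_from (n : nat) (w : word) : seq nat :=
  match w with
  | [::] => [::]
  | Lx :: w' => index_from n.+1 w'
  | Ly :: w' => n.+1 :: index_from 0 w'
  end.

Definition index_of (w : word) : seq nat := index_from 0 w.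

Lemma zwordK (k : seq nat) : all (fun i => 0 < i)%N k -> index_of (zword k) = k.
Proof.
rewrite /index_of.
have aux n m w :
    index_from n (rcons (nseq m Lx) Ly ++ w) = (n + m).+1 :: index_from 0 w.
  elim: m n => [|m IH] n /=; first by rewrite addn0.
  by rewrite IH addSnnS.
elim: k => [//|i k IH] /= /andP[i0 /IH k0].
by rewrite /zword /= aux add0n prednK // -[in RHS]k0.
Qed.

Lemma index_ofK (w : word) : last Ly w = Ly -> zword (index_of w) = w.
Proof.
have aux n : last Ly (nseq n Lx ++ w) = Ly ->
    zword (index_from n w) = nseq n Lx ++ w.
  elim: w n => [|a w IH] n.
    case: n => // n; rewrite cats0 /=.
    by elim: n => [|n IH] //= /IH.
  rewrite last_cat; case: a => /= lw.
  - have e : nseq n.+1 Lx ++ w = nseq n Lx ++ Lx :: w.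
      by rewrite -[n.+1]addn1 nseqD -catA.
    by rewrite IH e // last_cat.
  - by rewrite /zword /= -/(zword _) IH // cat_rcons.
exact: (aux 0%N).
Qed.

Fixpoint tharmonic_index (k : seq nat) : seq nat -> ht :=
  match k with
  | [::] => fun l => mon (zword l)
  | k1 :: k' =>
    fix aux (l : seq nat) : ht :=
      match l with
      | [::] => mon (zword (k1 :: k'))
      | l1 :: l' =>
          z_ k1 * tharmonic_index k' (l1 :: l')
        + z_ l1 * aux l'
        + (1 - 2%:R * tvar) *: (z_ (k1 + l1) * tharmonic_index k' l')
        + ((1 - delta k' * delta l') * (tvar ^+ 2 - tvar)) *:
            (lx ^+ (k1 + l1) * tharmonic_index k' l')
      end
  end.

(* Meaningful on in_h1 only, see index_of. *)
Definition tharmonic : ht -> ht -> ht :=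
  bilin_ext (fun u v => tharmonic_index (index_of u) (index_of v)).

Lemma tharmonic_index1w l : tharmonic_index [::] l = mon (zword l).
Proof. by []. Qed.

Lemma tharmonic_indexw1 k : tharmonic_index k [::] = mon (zword k).
Proof. by case: k. Qed.

Lemma tharmonic_index_cons k1 k l1 l :
  tharmonic_index (k1 :: k) (l1 :: l) =
    z_ k1 * tharmonic_index k (l1 :: l) + z_ l1 * tharmonic_index (k1 :: k) l
    + (1 - 2%:R * tvar) *: (z_ (k1 + l1) * tharmonic_index k l)
    + ((1 - delta k * delta l) * (tvar ^+ 2 - tvar)) *:
        (lx ^+ (k1 + l1) * tharmonic_index k l).
Proof. by []. Qed.

Lemma bilin_ext_mon F u v : bilin_ext F (mon u) (mon v) = F u v.
Proof.
rewrite /bilin_ext /mon !msuppU oner_eq0 !big_seq_fset1.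
by rewrite !mcoeffUU mulr1 scale1r.
Qed.

(* The sum over N > m_1 > ... > m_n > 0 of 1 / (m_1 ^ k_1 ... m_n ^ k_n). *)
Fixpoint mzv_trunc (R : realType) (k : seq nat) (N : nat) : R :=
  match k with
  | [::] => 1
  | k1 :: k' => \sum_(1 <= m < N) (m%:R ^- k1) * mzv_trunc R k' m
  end.

Definition mzv (R : realType) (k : seq nat) : R := limn (mzv_trunc R k).

(* All ways of filling the boxes of (k_1 [] k_2 [] ... [] k_n), each with a
   comma or a plus. *)
Fixpoint boxings (k : seq nat) : seq (seq nat) :=
  match k with
  | [::] => [:: [::]]
  | [:: k1] => [:: [:: k1]]
  | k1 :: k' => [seq k1 :: p | p <- boxings k']
             ++ [seq (k1 + head 0 p)%N :: behead p | p <- boxings k']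
  end.

Definition mzvt (R : realType) (k : seq nat) : {poly R} :=
  \sum_(p <- boxings k) mzv R p *: 'X^(size k - size p).

(* The coefficient embedding Q[t] -> R[t]. *)
Definition tcoef (R : realType) (c : {poly rat}) : {poly R} := map_poly ratr c.

(* Meaningful on in_h0 only. *)
Definition Zt (R : realType) (f : ht) : {poly R} :=
  \sum_(w <- msupp f) tcoef R (mcoeff w f) * mzvt R (index_of w).

(* Z is the algebra homomorphism (h1, prod) -> R[t, T] extending Zt and sending
   y to T. R[t, T] is {poly {poly R}}, with T the outer variable and t the
   inner one; values of Z outside h1 are irrelevant. *)
Record regularization (R : realType) (prod : ht -> ht -> ht)
    (Z : ht -> {poly {poly R}}) : Prop := Regularization {
  reg_linear : forall (c : {poly rat}) (f g : ht), in_h1 f -> in_h1 g ->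
    Z (c *: f + g) = (tcoef R c)%:P * Z f + Z g;
  reg_mul : forall f g : ht, in_h1 f -> in_h1 g ->
    Z (prod f g) = Z f * Z g;
  reg_h0 : forall f : ht, in_h0 f -> Z f = (Zt R f)%:P;
  reg_y : Z ly = 'X
}.

(* Main.v *)
(* Evaluate t at a real tau >= 0. To a word w attach the sequence a_w with a_1 = [m = 0],
   a_{xw}(m) = a_w(m) / m and a_{yw}(m) = (a_w(0) + ... + a_w(m-1) + tau a_w(m)) / m, its
   partial sums S_w(N) and the power series L_w(z) = (1 - z) sum_N S_w(N) z^N. Then S is
   multiplicative for the t-harmonic product, L_y L_w = L_{y sh w}, and for w0 in h0 both
   S_{w0}(N) and L_{w0}(1 - 1/N) tend to Z_t(w0), faster than any power of log N grows.
   Since h1 = h0[y] for either product, S_w and L_w are asymptotically the polynomials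
   Z^*(w) and Z^sh(w) evaluated at S_y and L_y, which both grow like log N.

   As S_{w1 * w0} = S_{w1} S_{w0} = Z_t(w0) S_{w1} + o(1), Abel means give
   L_{w1 * w0} = Z_t(w0) L_{w1} + o(1), so that Z^sh(w1 * w0) = Z_t(w0) Z^sh(w1) =
   Z^sh(w1 sh w0). Conversely Z^sh(g) = 0 forces Z^*(g) = 0: otherwise S_g would keep a sign
   and stay away from 0, and so would its Abel means L_g, which tend to 0. *)
From HB Require Import structures.
Require Import Defs.
From mathcomp Require Import all_boot all_order all_algebra.
From mathcomp Require Import finmap.
From mathcomp Require Import multinomials.monalg.
From mathcomp Require Import boolp classical_sets functions reals topology normedtype.
From mathcomp Require Import sequences.
From mathcomp Require Import ring lra zify.

Set Implicit Arguments.
Unset Strict Implicit.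
Unset Printing Implicit Defensive.

Import Order.TTheory GRing.Theory Num.Theory numFieldNormedType.Exports.
Local Open Scope ring_scope.

(** * Words and linear extension *)

(** Restricting to tau >= 0 makes every coefficient sequence nonnegative, so that Cauchy products
    and the convergence of all series reduce to monotone bounded sequences; a polynomial in t that
    vanishes at all tau >= 0 is still 0.

    The two equalities are not symmetric. Passing from partial sums to Abel means is elementary,
    whereas the way back would be Tauberian. What replaces a Tauberian theorem is rigidity: S_g is a
    polynomial in a quantity tending to infinity, up to o(1), so unless that polynomial is 0 it
    cannot oscillate or decay.

    On the shuffle side only products by y are computed: they are what the reduction to h0[y] uses,
    and the value at w1 sh w0 comes from the multiplicativity of Z^sh. On the harmonic side the
    product of two arbitrary elements enters, through S_{w1 * w0}.

    Convergence faster than any power of log N is forced twice: each product by y multiplies an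
    error by a quantity of size log N, and S_{w1} itself may grow like a power of log N when it
    multiplies Z_t(w0) - S_{w0}. *)

Definition lin_closed (E : ht -> Prop) : Prop :=
  E 0 /\ forall (c : {poly rat}) (f g : ht), E f -> E g -> E (c *: f + g).

(** Membership in h1, in h0 or in a step of the filtration by leading letters y becomes a condition
    on words, so that one induction principle, [wspan_ind], serves all three. *)
Definition wspan (P : pred word) (f : ht) : Prop :=
  forall w : word, mcoeff (FMonom w) f != 0 -> P w.

Section MonoidAlgebra.
Variables (K : choiceType) (M : monomType) (A : comNzRingType).

Lemma malg_sum (f : {malg A[K]}) : f = \sum_(k <- msupp f) mcoeff k f *: << k >>.
Proof.
rewrite {1}[f]monalgE; apply: eq_bigr => k _.
by apply/malgP => v; rewrite mcoeffZ !mcoeffU mulr_natr.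
Qed.

(** An Lalgebra moves scalars through the left factor only; commutativity of the coefficient ring
    gives the right factor. *)
Lemma malg_scalerAr (c : A) (f g : {malg A[M]}) : f * (c *: g) = c *: (f * g).
Proof.
apply/malgP => k; rewrite mcoeffZ (mcoeffMl f g).
rewrite (@mcoeffMlw _ _ (msupp f) (msupp g)) ?msuppZ_le //.
rewrite mulr_sumr; apply: eq_bigr => u _; rewrite mulr_sumr.
by apply: eq_bigr => v _; rewrite mcoeffZ mulrCA mulrnAr.
Qed.

End MonoidAlgebra.

Lemma ht_sum_mon (f : ht) : f = \sum_(k <- msupp f) mcoeff k f *: mon k.
Proof.
rewrite {1}[f]malg_sum; apply: eq_bigr => -[w] _; exact: erefl.
Qed.

Lemma mcoeff_mon (u v : word) : mcoeff (FMonom v) (mon u) = (u == v)%:R.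
Proof. by rewrite mcoeffU1. Qed.

Lemma mon_nil : mon [::] = 1.
Proof. by congr mkmalgU; rewrite /mone /one /= fmoneE. Qed.

Lemma mon_cat (u v : word) : mon (u ++ v) = mon u * mon v.
Proof.
rewrite /mon malgM_def fgmulUU mulr1; congr mkmalgU.
by rewrite /mmul /mul /= fmmulE.
Qed.

Lemma ht_scalerAr (c : {poly rat}) (f g : ht) : f * (c *: g) = c *: (f * g).
Proof. exact: malg_scalerAr. Qed.

Lemma ht_scalerAl (c : {poly rat}) (f g : ht) : (c *: f) * g = c *: (f * g).
Proof. exact/esym/scalerAl. Qed.

Lemma lin_closedZ E c f : lin_closed E -> E f -> E (c *: f).
Proof. by move=> [E0 EL] Ef; rewrite -[_ *: f]addr0; apply: EL. Qed.

Lemma lin_closedD E f g : lin_closed E -> E f -> E g -> E (f + g).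
Proof. by move=> [E0 EL] Ef Eg; rewrite -[f]scale1r; apply: EL. Qed.

Lemma lin_closedB E f g : lin_closed E -> E f -> E g -> E (f - g).
Proof. by move=> [E0 EL] Ef Eg; rewrite -scaleN1r addrC; apply: EL. Qed.

Lemma lin_closed_sum E (I : eqType) (s : seq I) (F : I -> ht) :
  lin_closed E -> (forall i, i \in s -> E (F i)) -> E (\sum_(i <- s) F i).
Proof.
move=> EL EF; rewrite big_seq; apply: (big_ind E) => //; first exact: EL.1.
by move=> f g; apply: lin_closedD.
Qed.

Lemma wspan_lin P : lin_closed (wspan P).
Proof.
split=> [w|c f g Pf Pg w]; first by rewrite mcoeff0 eqxx.
rewrite mcoeffD mcoeffZ.
have [f0|/Pf //] := eqVneq (mcoeff (FMonom w) f) 0.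
by rewrite f0 mulr0 add0r => Hw; apply: Pg.
Qed.

Lemma wspan_mon (P : pred word) (w : word) : P w -> wspan P (mon w).
Proof. by move=> Pw v; rewrite mcoeff_mon; have [<-|_] := eqVneq w v; rewrite ?mulr0n ?eqxx. Qed.

Lemma wspan_ind (P : pred word) (E : ht -> Prop) (f : ht) :
  lin_closed E -> (forall w, P w -> E (mon w)) -> wspan P f -> E f.
Proof.
move=> EL EP Pf; rewrite [f]ht_sum_mon; apply: lin_closed_sum => // -[w] wf.
by apply: lin_closedZ => //; apply/EP/Pf; rewrite mcoeff_neq0.
Qed.

Lemma ht_ind (E : ht -> Prop) (f : ht) :
  lin_closed E -> (forall w, E (mon w)) -> E f.
Proof. by move=> EL Ew; apply: (@wspan_ind predT). Qed.

Lemma wspan_sub (P Q : pred word) f : subpred P Q -> wspan P f -> wspan Q f.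
Proof. by move=> PQ Pf w /Pf /PQ. Qed.

Lemma wspan_mul (P Q S : pred word) f g :
  (forall u v, P u -> Q v -> S (u ++ v)) ->
  wspan P f -> wspan Q g -> wspan S (f * g).
Proof.
move=> PQS Pf Qg; have SL := @wspan_lin S.
apply: (@wspan_ind P (fun f => wspan S (f * g))) Pf => [|u Pu].
  split=> [|c f1 f2 S1 S2]; first by rewrite mul0r; case: SL.
  by rewrite mulrDl ht_scalerAl; apply: SL.2.
apply: (@wspan_ind Q (fun g => wspan S (mon u * g))) Qg => [|v Qv].
  split=> [|c f1 f2 S1 S2]; first by rewrite mulr0; case: SL.
  by rewrite mulrDr ht_scalerAr; apply: SL.2.
by rewrite -mon_cat; apply/wspan_mon/PQS.
Qed.

Section SumOverWords.
Variables (V : nmodType) (H : {poly rat} -> word -> V).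
Hypothesis H0 : forall w, H 0 w = 0.

Lemma sum_msupp_widen (f : ht) (d : {fset {fmonom letter}}) : (msupp f `<=` d)%fset ->
  \sum_(w <- msupp f) H (mcoeff w f) w = \sum_(w <- d) H (mcoeff w f) w.
Proof.
move=> fd; apply: big_fset_incl => // w _ wf.
by rewrite mcoeff_outdom // H0.
Qed.
End SumOverWords.

(** The three sums run over different supports, and cancellation may shrink that of c f + g. Since H
    0 w = 0, all can be widened to the union of the supports of f and g, where the identity is
    termwise. *)
Lemma sum_msupp_lin (V : nmodType) (H : {poly rat} -> word -> V) (c : {poly rat})
    (L : V -> V) (f g : ht) :
  {morph L : x y / x + y} -> L 0 = 0 -> (forall w, H 0 w = 0) ->
  (forall a b w, H (c * a + b) w = L (H a w) + H b w) ->
  \sum_(w <- msupp (c *: f + g)) H (mcoeff w (c *: f + g)) w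
  = L (\sum_(w <- msupp f) H (mcoeff w f) w) + \sum_(w <- msupp g) H (mcoeff w g) w.
Proof.
move=> LD L0 H0 HL; pose d := (msupp f `|` msupp g)%fset.
have le : (msupp (c *: f + g) `<=` d)%fset.
  apply: (fsubset_trans (msuppD_le _ _)); apply: fsetSU; exact: msuppZ_le.
rewrite (@sum_msupp_widen _ _ H0 _ _ le).
rewrite (@sum_msupp_widen _ _ H0 f d) ?fsubsetUl //.
rewrite (@sum_msupp_widen _ _ H0 g d) ?fsubsetUr //.
rewrite (big_morph L LD L0) -big_split; apply: eq_bigr => w _ /=.
by rewrite mcoeffD mcoeffZ HL.
Qed.

Lemma bilin_extDl F (c : {poly rat}) (f1 f2 g : ht) :
  bilin_ext F (c *: f1 + f2) g = c *: bilin_ext F f1 g + bilin_ext F f2 g.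
Proof.
have E f : bilin_ext F f g = \sum_(u <- msupp f)
    mcoeff u f *: \sum_(v <- msupp g) mcoeff v g *: F u v.
  apply: eq_bigr => u _; rewrite scaler_sumr.
  by apply: eq_bigr => v _; rewrite scalerA.
rewrite !E; apply: (@sum_msupp_lin _ (fun a u => a *:
    \sum_(v <- msupp g) mcoeff v g *: F u v) c ( *:%R c)).
- exact: scalerDr.
- exact: scaler0.
- by move=> w; rewrite scale0r.
- by move=> a b w; rewrite scalerDl scalerA.
Qed.

Lemma bilin_extDr F (c : {poly rat}) (f g1 g2 : ht) :
  bilin_ext F f (c *: g1 + g2) = c *: bilin_ext F f g1 + bilin_ext F f g2.
Proof.
have E g : bilin_ext F f g = \sum_(v <- msupp g)
    mcoeff v g *: \sum_(u <- msupp f) mcoeff u f *: F u v.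
  rewrite /bilin_ext exchange_big; apply: eq_bigr => v _; rewrite scaler_sumr.
  by apply: eq_bigr => u _; rewrite scalerA mulrC.
rewrite !E; apply: (@sum_msupp_lin _ (fun a v => a *:
    \sum_(u <- msupp f) mcoeff u f *: F u v) c ( *:%R c)).
- exact: scalerDr.
- exact: scaler0.
- by move=> w; rewrite scale0r.
- by move=> a b w; rewrite scalerDl scalerA.
Qed.

Lemma bilin_ext0l F g : bilin_ext F 0 g = 0.
Proof. by rewrite /bilin_ext msupp0 big_nil. Qed.

Lemma bilin_ext0r F f : bilin_ext F f 0 = 0.
Proof. by rewrite /bilin_ext msupp0; under eq_bigr do rewrite big_nil; rewrite big1. Qed.

Section WordFunctional.
Variables (A : nzRingType) (e : {rmorphism {poly rat} -> A}) (phi : word -> A).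

Definition wlin (f : ht) : A := \sum_(w <- msupp f) e (mcoeff w f) * phi w.

Lemma wlin_linear c f g : wlin (c *: f + g) = e c * wlin f + wlin g.
Proof.
apply: (@sum_msupp_lin _ (fun a w => e a * phi w) c ( *%R (e c))).
- exact: mulrDr.
- exact: mulr0.
- by move=> w; rewrite rmorph0 mul0r.
- by move=> a b w; rewrite rmorphD rmorphM mulrDl mulrA.
Qed.

Lemma wlin0 : wlin 0 = 0.
Proof. by rewrite /wlin msupp0 big_nil. Qed.

Lemma wlinZ c f : wlin (c *: f) = e c * wlin f.
Proof. by rewrite -[c *: f]addr0 wlin_linear wlin0 addr0. Qed.

Lemma wlinD f g : wlin (f + g) = wlin f + wlin g.
Proof. by rewrite -[f]scale1r wlin_linear rmorph1 mul1r scale1r. Qed.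

Lemma wlinB f g : wlin (f - g) = wlin f - wlin g.
Proof. by rewrite -[- g]scaleN1r wlinD wlinZ rmorphN1 mulN1r. Qed.

Lemma wlin_mon w : wlin (mon w) = phi w.
Proof.
by rewrite /wlin msuppU oner_eq0 big_seq_fset1 mcoeffUU rmorph1 mul1r.
Qed.

End WordFunctional.

(* The default value Ly makes the empty word a word of h1, but not one of h1word_pos. *)
Definition h1word : pred word := fun w => last Ly w == Ly.
Definition h1word_pos : pred word := fun w => last Lx w == Ly.
Definition h0word : pred word := fun w => h1word w && (head Lx w == Lx).

Lemma h1word_cat u v : h1word u -> h1word v -> h1word (u ++ v).
Proof. by rewrite /h1word last_cat => /eqP ->. Qed.

Lemma h1word_pos_cat u v : h1word_pos v -> h1word_pos (u ++ v).
Proof. by case: v => // a v; rewrite /h1word_pos last_cat. Qed.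

Lemma h1word_posW : subpred h1word_pos h1word.
Proof. by case. Qed.

Section LalgebraCombinations.
Variables (K : pzRingType) (V : lalgType K).
Implicit Types (c : K) (g x l : V).

Lemma comb_mulr c c1 c2 g1 g2 l :
  c *: (c1 *: 1 + g1 * l) + (c2 *: 1 + g2 * l)
  = (c * c1 + c2) *: 1 + (c *: g1 + g2) * l.
Proof. by rewrite scalerDl mulrDl scalerDr scalerA scalerAl addrACA. Qed.

Lemma comb_mullr c c1 c2 x g1 g2 l : x * (c *: g1) = c *: (x * g1) ->
  c *: (c1 *: 1 + x * g1 * l) + (c2 *: 1 + x * g2 * l)
  = (c * c1 + c2) *: 1 + x * (c *: g1 + g2) * l.
Proof. by move=> xg; rewrite comb_mulr mulrDr xg. Qed.

End LalgebraCombinations.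

Lemma in_h1P f : in_h1 f <-> wspan h1word f.
Proof.
split=> [[c [g ->]]|].
  apply: (@wspan_lin h1word).2; first by rewrite -mon_nil; apply: wspan_mon.
  apply: (@wspan_mul predT (pred1 [:: Ly])) => //; last exact: wspan_mon.
  by move=> u v _ /eqP ->; rewrite /h1word last_cat.
apply: wspan_ind => [|w].
  split=> [|c f1 f2 [c1 [g1 ->]] [c2 [g2 ->]]].
    by exists 0, 0; rewrite scale0r mul0r addr0.
  exists (c * c1 + c2), (c *: g1 + g2).
  exact: comb_mulr.
case/lastP: w => [_|w a]; first by exists 1, 0; rewrite mon_nil scale1r mul0r addr0.
rewrite /h1word last_rcons => /eqP ->.
by exists 0, (mon w); rewrite scale0r add0r -cats1 mon_cat.
Qed.

Lemma in_h0P f : in_h0 f <-> wspan h0word f.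
Proof.
split=> [[c [g ->]]|].
  apply: (@wspan_lin h0word).2; first by rewrite -mon_nil; apply: wspan_mon.
  apply: (@wspan_mul (fun w => head Ly w == Lx) (pred1 [:: Ly])) => //;
    last exact: wspan_mon.
    by move=> [|[] u] v // _ /eqP ->; rewrite /h0word /h1word last_cat.
  apply: (@wspan_mul (pred1 [:: Lx]) predT) => //; last exact: wspan_mon.
  by move=> u v /eqP ->.
apply: wspan_ind => [|w].
  split=> [|c f1 f2 [c1 [g1 ->]] [c2 [g2 ->]]].
    by exists 0, 0; rewrite scale0r mulr0 mul0r addr0.
  exists (c * c1 + c2), (c *: g1 + g2).
  by apply: comb_mullr; apply: ht_scalerAr.
case: w => [_|a w]; first by exists 1, 0; rewrite mon_nil scale1r mulr0 mul0r addr0.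
case/lastP: w => [|w b]; rewrite /h0word /h1word; first by case: a.
rewrite /= last_rcons => /andP[/eqP -> /eqP ->].
exists 0, (mon w); rewrite scale0r add0r -cats1.
by rewrite -[_ :: _]/([:: Lx] ++ (w ++ [:: Ly])) !mon_cat mulrA.
Qed.

Lemma in_h0_h1 f : in_h0 f -> in_h1 f.
Proof.
by rewrite in_h0P in_h1P; apply: wspan_sub => w /andP[].
Qed.

(** * The two products on h1 *)

Lemma h1word_cons a w : h1word (a :: w) -> h1word w.
Proof. by case: w. Qed.

Lemma wspan_mulr_pos f g : wspan h1word_pos g -> wspan h1word_pos (f * g).
Proof. by apply: (@wspan_mul predT) => // u v _; apply: h1word_pos_cat. Qed.

(** Each correction term keeps one of the two nonempty words intact on its right, so the final
    letter y survives. *)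
Lemma tshuffle_word_h1 u v : h1word u -> h1word v -> (u != [::]) || (v != [::]) ->
  wspan h1word_pos (tshuffle_word u v).
Proof.
elim: u v => [|a u IHu] v hu hv; first by case: v hv => // b v hv _; apply: wspan_mon.
elim: v hv => [|b v IHv] hv _; first by rewrite tshuffle_wordw1; apply: wspan_mon.
rewrite tshuffle_word_cons; have L := wspan_lin h1word_pos.
apply: (lin_closedB L); [apply: (lin_closedB L); [apply: (lin_closedD L)|]|].
- by apply: wspan_mulr_pos; apply: IHu; rewrite ?orbT //; apply: h1word_cons hu.
- by apply: wspan_mulr_pos; apply: IHv => //; apply: h1word_cons hv.
- by apply: (lin_closedZ _ L); apply: wspan_mulr_pos; apply: wspan_mon.
- by apply: (lin_closedZ _ L); apply: wspan_mulr_pos; apply: wspan_mon.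
Qed.

Lemma zletters_pos k : h1word_pos (zletters k).
Proof. by rewrite /h1word_pos /zletters last_rcons. Qed.

Lemma zword_pos k l : h1word_pos (zword (k :: l)).
Proof.
elim: l k => [|i l IH] k; first by rewrite /zword /= cats0 zletters_pos.
by rewrite /zword /= ; apply: h1word_pos_cat; apply: IH.
Qed.

Lemma zword_h1 l : h1word (zword l).
Proof. by case: l => // k l; apply/h1word_posW/zword_pos. Qed.

Lemma wspan_mull_pos f g : wspan h1word_pos f -> wspan h1word g ->
  wspan h1word_pos (f * g).
Proof.
by apply: wspan_mul => u v; rewrite /h1word_pos last_cat => /eqP ->.
Qed.

(** The factor x^(k1 + l1) carries no y of its own, so it needs a remaining product all of whose
    words end in y. This fails only when both tails are empty, which is when its coefficient
    vanishes; hence the two statements proved together. *)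
Lemma tharmonic_index_h1 k l :
  wspan h1word (tharmonic_index k l) /\
  ((k != [::]) || (l != [::]) -> wspan h1word_pos (tharmonic_index k l)).
Proof.
have W f : wspan h1word_pos f -> wspan h1word f.
  exact/wspan_sub/h1word_posW.
elim: k l => [|k1 k IHk] l.
  split; first by apply/wspan_mon/zword_h1.
  by case: l => // l1 l _; apply/wspan_mon/zword_pos.
suff H : wspan h1word_pos (tharmonic_index (k1 :: k) l) by split=> [|_]; [exact: W|].
elim: l => [|l1 l IHl]; first by rewrite tharmonic_indexw1; apply/wspan_mon/zword_pos.
rewrite tharmonic_index_cons; have L := wspan_lin h1word_pos.
have zp i : wspan h1word_pos (z_ i) by apply/wspan_mon/zletters_pos.
apply: (lin_closedD L); [apply: (lin_closedD L); [apply: (lin_closedD L)|]|].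
- by apply: wspan_mull_pos => //; apply: (IHk _).1.
- by apply: wspan_mull_pos => //; apply: W.
- by apply: (lin_closedZ _ L); apply: wspan_mull_pos => //; apply: (IHk _).1.
- have [/andP[/eqP -> /eqP ->]|kl] := boolP ((k == [::]) && (l == [::])).
    by rewrite /delta /= mulr1 subrr mul0r scale0r; apply: L.1.
  apply: (lin_closedZ _ L); apply: wspan_mulr_pos; apply: (IHk _).2.
  by rewrite -negb_and.
Qed.

Lemma bilin_ext_h1 F : (forall u v, h1word u -> h1word v -> wspan h1word (F u v)) ->
  forall f g, in_h1 f -> in_h1 g -> in_h1 (bilin_ext F f g).
Proof.
move=> HF f g; rewrite !in_h1P => Hf Hg; have L := wspan_lin h1word.
apply: (@wspan_ind h1word (fun f => wspan h1word (bilin_ext F f g))) Hf => [|u hu].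
  by split=> [|c f1 f2 *]; rewrite ?bilin_ext0l ?bilin_extDl; [case: L|apply: L.2].
apply: (@wspan_ind h1word (fun g => wspan h1word (bilin_ext F (mon u) g))) Hg => [|v hv].
  by split=> [|c f1 f2 *]; rewrite ?bilin_ext0r ?bilin_extDr; [case: L|apply: L.2].
by rewrite bilin_ext_mon; apply: HF.
Qed.

Lemma tshuffle_h1 f g : in_h1 f -> in_h1 g -> in_h1 (tshuffle f g).
Proof.
apply: bilin_ext_h1 => u v hu hv.
have [/andP[/eqP -> /eqP ->]|uv] := boolP ((u == [::]) && (v == [::])).
  exact: wspan_mon.
by apply: (wspan_sub h1word_posW); apply: tshuffle_word_h1; rewrite // -negb_and.
Qed.

Lemma tharmonic_h1 f g : in_h1 f -> in_h1 g -> in_h1 (tharmonic f g).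
Proof. by apply: bilin_ext_h1 => u v _ _; apply: (tharmonic_index_h1 _ _).1. Qed.

(** The degree in y for h1 = h0[y]: among words of h1, those with [lead w = 0] are exactly the words
    of h0, and [lead] is the induction parameter of the asymptotics. *)
Fixpoint lead (w : word) : nat := if w is Ly :: v then (lead v).+1 else 0.

Definition h1word_lead (n : nat) : pred word := fun w => h1word w && (lead w <= n)%N.

(* This triangularity is what makes h1 = h0[y] hold for either product. *)
Definition ly_triangular (prod : ht -> ht -> ht) : Prop :=
  forall w, h1word w ->
    wspan (h1word_lead (lead w)) (prod ly (mon w) - mon (Ly :: w) *+ (lead w).+1).

Section RingIdentities.
Variables (V : nzRingType) (y A B C D m r : V) (n : nat).

Lemma triangular_base : A + B + C + D - A *+ 1 = B + C + D.
Proof. by rewrite mulr1n !(addrAC _ _ (- A)) subrr add0r. Qed.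

Lemma triangular_step : y * m = A ->
  A + y * (r + m *+ n) + C + D - A *+ n.+1 = y * r + C + D.
Proof.
move=> yA; rewrite mulrDr mulrnAr yA mulrS addrCA.
by rewrite !(addrAC _ _ (- (A + A *+ n))) subrK.
Qed.

End RingIdentities.

Lemma wspan_lead_mul n u f : h1word_pos u -> head Ly u = Lx -> wspan h1word f ->
  wspan (h1word_lead n) (mon u * f).
Proof.
move=> hu xu hf; apply: (@wspan_mul (pred1 u) h1word) hf;
  last by apply: wspan_mon; rewrite /= eqxx.
move=> _ v /eqP -> hv; rewrite /h1word_lead (h1word_cat (h1word_posW hu)) //=.
by case: u hu xu => [|[]].
Qed.

Lemma wspan_lead_mul_pos n u f : head Ly u = Lx -> wspan h1word_pos f ->
  wspan (h1word_lead n) (mon u * f).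
Proof.
move=> xu hf; apply: (@wspan_mul (pred1 u) h1word_pos) hf;
  last by apply: wspan_mon; rewrite /= eqxx.
move=> _ v /eqP -> hv; rewrite /h1word_lead h1word_posW ?h1word_pos_cat //=.
by case: u xu => [|[]].
Qed.

Lemma wspan_lead_ly n f : wspan (h1word_lead n) f -> wspan (h1word_lead n.+1) (ly * f).
Proof.
apply: (@wspan_mul (pred1 [:: Ly])) => [_ v /eqP ->|]; last exact: wspan_mon.
by rewrite /h1word_lead.
Qed.

(** Inserting y at one of the [lead w + 1] places of the initial run of y lengthens this run and
    gives y w each time; a later insertion leaves the run unchanged, and the corrections through
    [rho] put an x in its place. *)
Lemma tshuffle_triangular : ly_triangular tshuffle.
Proof.
move=> w; rewrite /tshuffle bilin_ext_mon.
elim: w => [_|b v IH hv]; first by rewrite mulr1n subrr; apply: (wspan_lin _).1.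
rewrite tshuffle_word_cons tshuffle_word1w -[mon [:: Ly] * _]mon_cat.
have L n := wspan_lin (h1word_lead n).
have C n c : wspan (h1word_lead n) (c *: (rho Ly * mon (b :: v))).
  rewrite /rho ht_scalerAl; do 2!apply: (lin_closedZ _ (L n)).
  by apply: wspan_lead_mul_pos => //; apply: wspan_mon.
have D n c : wspan (h1word_lead n) (c *: (rho b * mon [:: Ly])).
  case: (b); first by rewrite mul0r scaler0; apply: (L n).1.
  rewrite /rho ht_scalerAl; do 2!apply: (lin_closedZ _ (L n)).
  by apply: wspan_lead_mul_pos => //; apply: wspan_mon.
case: b hv C D => hv C D; last first.
  rewrite -[tshuffle_word [:: Ly] v](subrK (mon (Ly :: v) *+ (lead v).+1)).
  rewrite triangular_step; last by rewrite -mon_cat.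
  apply: (lin_closedB (L _)); last exact: D.
  apply: (lin_closedB (L _)); last exact: C.
  exact/wspan_lead_ly/IH.
rewrite triangular_base.
apply: (lin_closedB (L _)); last exact: D.
apply: (lin_closedB (L _)); last exact: C.
apply: wspan_lead_mul_pos => //; apply: tshuffle_word_h1 => //.
exact: h1word_cons hv.
Qed.

Lemma index_from_pos n w : h1word_pos w ->
  exists k l, [/\ index_from n w = k :: l, (n < k)%N & h1word_pos w].
Proof.
elim: w n => [|[] w IH] n // hw.
  have /IH - /(_ n.+1) [k [l [e nk _]]] : h1word_pos w by [].
  by exists k, l; split=> //; apply: ltnW.
by exists n.+1, (index_from 0 w).
Qed.

Lemma lx_exp n : lx ^+ n = mon (nseq n Lx).
Proof. by elim: n => [|n IH]; rewrite ?mon_nil // exprS IH -mon_cat. Qed.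

Lemma index_of_word w : h1word w -> zword (index_of w) = w.
Proof. by move/eqP; apply: index_ofK. Qed.

(** The merged terms z_{1+l} and x^(1+l) begin with x, and so does z_l when l >= 2. Only the initial
    letters z_1 = y let the run of y grow, whence the same multiplicity as for the shuffle
    product. *)
Lemma tharmonic_triangular : ly_triangular tharmonic.
Proof.
move=> w hw; rewrite /tharmonic bilin_ext_mon -[index_of [:: Ly]]/[:: 1%N].
have L n := wspan_lin (h1word_lead n).
have T k l n c : (0 < k)%N ->
    wspan (h1word_lead n) (c *: (z_ k.+1 * mon (zword l))).
  move=> k0; apply: (lin_closedZ _ (L n)); apply: wspan_lead_mul.
  - exact: zletters_pos.
  - by case: k k0.
  - by apply/wspan_mon/zword_h1.
have Q k l n : wspan (h1word_lead n)
    (((1 - delta ([::] : seq nat) * delta l) * (tvar ^+ 2 - tvar)) *: (lx ^+ k.+1 * mon (zword l))).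
  case: l => [|i l]; first by rewrite /delta /= mulr1 subrr mul0r scale0r; apply: (L n).1.
  apply: (lin_closedZ _ (L n)); rewrite lx_exp; apply: wspan_lead_mul_pos => //.
  by apply/wspan_mon/zword_pos.
elim: w hw => [_|b v IH hv]; first by rewrite mulr1n subrr; apply: (L _).1.
case: b hv => hv; last first.
  have {}IH := IH (h1word_cons hv).
  rewrite -[index_of _]/(1%N :: index_of v) tharmonic_index_cons tharmonic_index1w.
  rewrite tharmonic_index1w -[zword (_ :: _)]/(Ly :: zword (index_of v)).
  rewrite {1}index_of_word // -[z_ 1]/ly -mon_cat.
  rewrite -[tharmonic_index [:: 1%N] (index_of v)](subrK (mon (Ly :: v) *+ (lead v).+1)).
  rewrite triangular_step; last by rewrite -mon_cat.
  apply: (lin_closedD (L _)); last exact: Q.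
  apply: (lin_closedD (L _)); last exact: T.
  exact/wspan_lead_ly/IH.
have [k [l [e k1 _]]] := @index_from_pos 1 v hv.
have {}e : index_of (Lx :: v) = k :: l by [].
have ew : zword (k :: l) = Lx :: v by rewrite -e index_of_word.
rewrite e tharmonic_index_cons !tharmonic_index1w ew -[z_ 1]/ly -mon_cat.
rewrite triangular_base.
apply: (lin_closedD (L _)); last exact: Q.
apply: (lin_closedD (L _)); last by apply: T; apply: ltnW.
apply: wspan_lead_mul; [exact: zletters_pos|by case: k k1 {e ew} => [|[]]|].
exact: (tharmonic_index_h1 _ _).1.
Qed.

Lemma index_of_gt0 w : all (leq 1) (index_of w).
Proof.
suff H n : all (leq 1) (index_from n w) by apply: H.
by elim: w n => [|[] w IH] n //=; apply: IH.
Qed.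

(** * Coefficient sequences *)

Section Combinations.
Variables (A : nzRingType) (e : {rmorphism {poly rat} -> A}) (phi : word -> A).

Lemma wlin_comb (B C D E : ht) c d :
  wlin e phi (B + C + c *: D + d *: E) =
  wlin e phi B + wlin e phi C + e c * wlin e phi D + e d * wlin e phi E.
Proof. by rewrite wlinD [wlin _ _ (d *: E)]wlinZ wlinD wlinD [wlin _ _ (c *: D)]wlinZ. Qed.

Lemma wlin_combB (B C D E : ht) c d :
  wlin e phi (B + C - c *: D - d *: E) =
  wlin e phi B + wlin e phi C - e c * wlin e phi D - e d * wlin e phi E.
Proof. by rewrite wlinB [wlin _ _ (d *: E)]wlinZ wlinB wlinD [wlin _ _ (c *: D)]wlinZ. Qed.

End Combinations.

Lemma ht_mulr_lin (c : {poly rat}) (f g h : ht) :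
  f * (c *: g + h) = c *: (f * g) + f * h.
Proof. by rewrite mulrDr; congr (_ + _); apply: ht_scalerAr. Qed.

Section Evaluation.
Variables (R : realType) (tau : R).

Definition cev (c : {poly rat}) : R := (tcoef R c).[tau].

Lemma cev_is_additive : zmod_morphism cev.
Proof. by move=> c d; rewrite /cev /tcoef rmorphB hornerD hornerN. Qed.

Lemma cev_is_multiplicative : monoid_morphism cev.
Proof. by split=> [|c d]; rewrite /cev /tcoef ?rmorph1 ?hornerC ?rmorphM ?hornerM. Qed.

HB.instance Definition _ := GRing.isZmodMorphism.Build _ _ cev cev_is_additive.
HB.instance Definition _ := GRing.isMonoidMorphism.Build _ _ cev cev_is_multiplicative.

Lemma cev_tvar : cev tvar = tau.
Proof. by rewrite /cev /tcoef /tvar map_polyX hornerX. Qed.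

Lemma cev_delta (T : eqType) (s : seq T) : cev (delta s) = (s == [::])%:R.
Proof. by rewrite /delta rmorph_nat; case: s. Qed.

Definition cevr : {rmorphism {poly rat} -> R} := cev.

(* The coefficient of z^m in the interpolated polylogarithm: the t-analogue of
   iterated integration of dz/z (for x) and of dz/(1-z) + t dz/z (for y), the
   last y contributing dz/(1-z) only. At m = 0 the division yields 0. *)
Fixpoint acoef (w : word) (m : nat) : R :=
  match w with
  | [::] => (m == 0)%:R
  | Lx :: v => acoef v m / m%:R
  | Ly :: v => (\sum_(j < m) acoef v j + tau * acoef v m) / m%:R
  end.

Definition ssum (w : word) (N : nat) : R := \sum_(m < N.+1) acoef w m.

Definition acoefl (f : ht) (m : nat) : R := wlin cevr (acoef^~ m) f.
Definition ssuml (f : ht) (m : nat) : R := wlin cevr (ssum^~ m) f.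

Lemma acoef0 w : acoef w 0 = (w == [::])%:R.
Proof. by case: w => [|[] w] //=; rewrite invr0 mulr0. Qed.

Lemma acoef_nil m : acoef [::] m.+1 = 0.
Proof. by []. Qed.

Lemma ssum_nil m : ssum [::] m = 1.
Proof. by rewrite /ssum big_ord_recl /= big1 ?addr0. Qed.

Lemma ssum0 w : ssum w 0 = (w == [::])%:R.
Proof. by rewrite /ssum big_ord_recl big_ord0 addr0 acoef0. Qed.

Lemma ssumS w N : ssum w N.+1 = ssum w N + acoef w N.+1.
Proof. by rewrite /ssum big_ord_recr. Qed.

Lemma ssumlE f N : ssuml f N = \sum_(m < N.+1) acoefl f m.
Proof.
rewrite /ssuml /acoefl /wlin exchange_big; apply: eq_bigr => w _.
by rewrite -mulr_sumr.
Qed.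

Lemma acoefl_linear c f g m : acoefl (c *: f + g) m = cev c * acoefl f m + acoefl g m.
Proof. exact: wlin_linear. Qed.

Lemma ssuml_linear c f g m : ssuml (c *: f + g) m = cev c * ssuml f m + ssuml g m.
Proof. exact: wlin_linear. Qed.

Lemma acoefl_mon w m : acoefl (mon w) m = acoef w m.
Proof. exact: wlin_mon. Qed.

Lemma ssuml_mon w m : ssuml (mon w) m = ssum w m.
Proof. exact: wlin_mon. Qed.

Lemma acoefl0 m : acoefl 0 m = 0. Proof. exact: wlin0. Qed.

Lemma acoefl_lx f m : acoefl (mon [:: Lx] * f) m = acoefl f m / m%:R.
Proof.
apply: (@ht_ind (fun f => acoefl (mon [:: Lx] * f) m = acoefl f m / m%:R)) => [|w].
  split=> [|c g h Hg Hh]; first by rewrite mulr0 acoefl0 mul0r.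
  rewrite ht_mulr_lin [LHS]acoefl_linear [X in _ * X + _]Hg [X in _ + X]Hh.
  by rewrite [X in _ = X / _]acoefl_linear mulrDl mulrA.
by rewrite -mon_cat !acoefl_mon.
Qed.

Lemma acoefl_ly f m : acoefl (mon [:: Ly] * f) m =
  (\sum_(j < m) acoefl f j + tau * acoefl f m) / m%:R.
Proof.
apply: (@ht_ind (fun f => acoefl (mon [:: Ly] * f) m =
    (\sum_(j < m) acoefl f j + tau * acoefl f m) / m%:R)) => [|w].
  split=> [|c g h Hg Hh].
    by rewrite mulr0 !acoefl0 big1 ?mulr0 ?addr0 ?mul0r // => j _; rewrite acoefl0.
  have -> : \sum_(j < m) acoefl (c *: g + h) j =
      cev c * (\sum_(j < m) acoefl g j) + \sum_(j < m) acoefl h j.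
    rewrite mulr_sumr -big_split; apply: eq_bigr => j _; exact: acoefl_linear.
  rewrite ht_mulr_lin [LHS]acoefl_linear [X in _ * X + _]Hg [X in _ + X]Hh.
  rewrite [X in _ = (_ + tau * X) / _]acoefl_linear.
  by ring.
by rewrite -mon_cat !acoefl_mon /=; under [in RHS]eq_bigr do rewrite acoefl_mon.
Qed.

Lemma acoefl_lxn n f m : acoefl (lx ^+ n * f) m = acoefl f m / m%:R ^+ n.
Proof.
elim: n => [|n IH]; first by rewrite expr0 mul1r expr0 divr1.
by rewrite exprS -mulrA acoefl_lx IH exprSr invfM mulrA.
Qed.

Lemma acoefl_z k f m : (0 < k)%N -> acoefl (z_ k * f) m =
  (\sum_(j < m) acoefl f j + tau * acoefl f m) / m%:R ^+ k.
Proof.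
case: k => // k _; rewrite /z_ /zletters -cats1 mon_cat -lx_exp -mulrA.
by rewrite acoefl_lxn acoefl_ly exprS invfM mulrA.
Qed.


Lemma ssum_prefix w N : ssum w N = \sum_(j < N) acoef w j + acoef w N.
Proof. by rewrite /ssum big_ord_recr. Qed.

Lemma ssumlS f N : ssuml f N.+1 = ssuml f N + acoefl f N.+1.
Proof. by rewrite !ssumlE big_ord_recr. Qed.

Lemma ssuml_prefix f N : \sum_(j < N) acoefl f j = ssuml f N - acoefl f N.
Proof. by rewrite ssumlE big_ord_recr /= addrK. Qed.

(** Unfolded, this is a nested sum in which equality of two consecutive summation indices has weight
    tau: tau = 0 gives strict inequalities and tau = 1 weak ones. *)
Lemma acoef_zword k l m : (0 < k)%N ->
  acoef (zword (k :: l)) m = (ssum (zword l) m - acoef (zword l) m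
    + tau * acoef (zword l) m) / m%:R ^+ k.
Proof.
move=> k0; rewrite -acoefl_mon /zword /= mon_cat acoefl_z //.
by rewrite ssuml_prefix ssuml_mon !acoefl_mon.
Qed.

Lemma zword_nil l : all (leq 1) l -> (zword l == [::]) = (l == [::]).
Proof. by case: l => [|i l] //= _; apply/negbTE; case: i => [|[]]. Qed.

Lemma cevr_coef1 : cevr (1 - 2%:R * tvar) = 1 - 2 * tau.
Proof. by rewrite rmorphB rmorph1 rmorphM rmorph_nat /= cev_tvar. Qed.

Lemma cevr_coef2 (k l : seq nat) :
  cevr ((1 - delta k * delta l) * (tvar ^+ 2 - tvar)) =
  (1 - (k == [::])%:R * (l == [::])%:R) * (tau ^+ 2 - tau).
Proof. by rewrite rmorphM !rmorphB rmorph1 rmorphM rmorphXn /= !cev_delta cev_tvar. Qed.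

(* By induction S_{u * v} = S_u S_v, i.e., a_{u * v} = a_u S_v + S_u a_v - a_u a_v, for the
   three products on the right-hand side of the recursion. *)
Lemma ssuml_tharmonic_index k l N : all (leq 1) k -> all (leq 1) l ->
  ssuml (tharmonic_index k l) N = ssum (zword k) N * ssum (zword l) N.
Proof.
elim: k l N => [|k1 k IHk] l N; first by rewrite tharmonic_index1w ssuml_mon ssum_nil mul1r.
elim: l N => [|l1 l IHl] N pk pl; first by rewrite tharmonic_indexw1 ssuml_mon ssum_nil mulr1.
have /andP[k10 pk'] : (0 < k1)%N && all (leq 1) k by [].
have /andP[l10 pl'] : (0 < l1)%N && all (leq 1) l by [].
have aE f (u v : word) : (forall N, ssuml f N = ssum u N * ssum v N) -> forall m,
    acoefl f m.+1 = acoef u m.+1 * ssum v m.+1 + ssum u m.+1 * acoef v m.+1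
      - acoef u m.+1 * acoef v m.+1.
  by move=> H m; have := H m.+1; rewrite ssumlS H !ssumS => /(canRL (addKr _)) ->; ring.
have e1 N' := IHk (l1 :: l) N' pk' pl.
have e2 N' := IHl N' pk pl'.
have e3 N' := IHk l N' pk' pl'.
have aT m : acoefl (tharmonic_index (k1 :: k) (l1 :: l)) m =
    (\sum_(j < m) acoefl (tharmonic_index k (l1 :: l)) j
      + tau * acoefl (tharmonic_index k (l1 :: l)) m) / m%:R ^+ k1
    + (\sum_(j < m) acoefl (tharmonic_index (k1 :: k) l) j
      + tau * acoefl (tharmonic_index (k1 :: k) l) m) / m%:R ^+ l1
    + (1 - 2 * tau) * ((\sum_(j < m) acoefl (tharmonic_index k l) j
      + tau * acoefl (tharmonic_index k l) m) / m%:R ^+ (k1 + l1))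
    + (1 - (k == [::])%:R * (l == [::])%:R) * (tau ^+ 2 - tau) *
        (acoefl (tharmonic_index k l) m / m%:R ^+ (k1 + l1)).
  rewrite tharmonic_index_cons [LHS]wlin_comb cevr_coef1 cevr_coef2.
  congr (_ + _ + _ * _ + _ * _).
  - exact: acoefl_z.
  - exact: acoefl_z.
  - by apply: acoefl_z; rewrite addn_gt0 k10.
  - exact: acoefl_lxn.
elim: N => [|N IHN].
  rewrite !ssum0 (zword_nil pk) mul0r ssumlE big_ord_recl big_ord0 addr0 aT.
  by rewrite !expr0n addn_eq0 !gtn_eqF // invr0 !mulr0 !addr0.
rewrite ssumlS IHN aT !ssuml_prefix (aE _ _ _ e1) (aE _ _ _ e2) (aE _ _ _ e3) e1 e2 e3.
rewrite !ssumS !(@acoef_zword _ _ N.+1) // !ssumS exprD invfM.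
(* For empty tails the x^(k1 + l1) term is switched off, but it would multiply the sequence of the
   empty word, which is 0 at N+1; so both cases satisfy the same identity. *)
have [/andP[/eqP -> /eqP ->]|kl] := boolP ((k == [::]) && (l == [::])).
  by rewrite -[zword [::]]/[::] !acoef_nil; ring.
have -> : (k == [::])%:R * (l == [::])%:R = 0 :> R.
  by rewrite -natrM mulnb (negbTE kl).
by ring.
Qed.

End Evaluation.

(** * Cauchy products and the shuffle product by y *)

Section Convolution.
Variable A : comNzRingType.
Implicit Types a b : nat -> A.

Definition convol a b (m : nat) : A := \sum_(i < m.+1) a i * b (m - i)%N.

(** The derivation z d/dz, read on coefficients. *)
Lemma convol_leibniz a b m : m%:R * convol a b m =
  convol (fun i => i%:R * a i) b m + convol a (fun i => i%:R * b i) m.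
Proof.
rewrite /convol -big_split mulr_sumr; apply: eq_bigr => i _ /=.
rewrite -{1}(@subnKC i m) ?natrD; last by rewrite -ltnS.
by ring.
Qed.

(** Strict prefix sums are multiplication by z / (1 - z), which can be applied to one factor or to
    the product. *)
Lemma convol_prefix a b m :
  convol a (fun i => \sum_(j < i) b j) m = \sum_(l < m) convol a b l.
Proof.
elim: m => [|m IH]; first by rewrite /convol big_ord_recl !big_ord0 mulr0 addr0.
rewrite big_ord_recr /= -IH {1}/convol big_ord_recr /= subnn big_ord0 mulr0 addr0.
rewrite /convol -big_split; apply: eq_bigr => i _ /=.
by rewrite subSn ?big_ord_recr ?mulrDr // -ltnS.
Qed.

Lemma convol_rev a b m : convol a b m = convol b a m.
Proof.
rewrite /convol (reindex_inj rev_ord_inj); apply: eq_bigr => i _ /=.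
rewrite subSS subKn; last by rewrite -ltnS.
exact: mulrC.
Qed.

Lemma convol_geo a m : convol a (fun=> 1) m = \sum_(j < m.+1) a j.
Proof. by apply: eq_bigr => i _; rewrite mulr1. Qed.

End Convolution.

Section TauCoefficients.
Variables (R : realType) (tau : R).
Notation acoef := (@acoef R tau).
Notation ssum := (@ssum R tau).
Notation acoefl := (@acoefl R tau).
Notation ssuml := (@ssuml R tau).

Lemma ssuml_tharmonic f g N : in_h1 f -> in_h1 g ->
  ssuml (tharmonic f g) N = ssuml f N * ssuml g N.
Proof.
rewrite !in_h1P => Hf Hg.
apply: (@wspan_ind h1word (fun f => ssuml (tharmonic f g) N = ssuml f N * ssuml g N)) Hf => [|u hu].
  split=> [|c f1 f2 H1 H2]; first by rewrite /tharmonic bilin_ext0l /ssuml !wlin0 mul0r.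
  rewrite /tharmonic bilin_extDl [LHS]ssuml_linear [X in _ * X + _]H1 [X in _ + X]H2.
  by rewrite [X in _ = X * _]ssuml_linear mulrDl mulrA.
apply: (@wspan_ind h1word (fun g =>
  ssuml (tharmonic (mon u) g) N = ssuml (mon u) N * ssuml g N)) Hg => [|v hv].
  split=> [|c f1 f2 H1 H2]; first by rewrite /tharmonic bilin_ext0r /ssuml !wlin0 mulr0.
  rewrite /tharmonic bilin_extDr [LHS]ssuml_linear [X in _ * X + _]H1 [X in _ + X]H2.
  by rewrite [X in _ = _ * X]ssuml_linear mulrDr mulrCA.
rewrite /tharmonic bilin_ext_mon ssuml_tharmonic_index ?index_of_gt0 //.
by rewrite !index_of_word // !ssuml_mon.
Qed.

Lemma acoef_y i : acoef [:: Ly] i = i%:R^-1.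
Proof.
case: i => [|i]; first by rewrite acoef0 invr0.
by rewrite /= big_ord_recl /= big1 // mulr0 !addr0 mul1r.
Qed.

Lemma acoefl_rho_ly f m : acoefl (rho Ly * f) m = tau * (acoefl f m / m%:R).
Proof.
by rewrite /rho ht_scalerAl [LHS]wlinZ [X in _ * X](acoefl_lx tau f m) /= cev_tvar.
Qed.

Lemma acoefl_rho_lx f m : acoefl (rho Lx * f) m = 0.
Proof. by rewrite mul0r acoefl0. Qed.

Lemma acoefl_mon_cons0 b f : acoefl (mon [:: b] * f) 0 = 0.
Proof. by case: b; [rewrite acoefl_lx|rewrite acoefl_ly]; rewrite invr0 mulr0. Qed.

Lemma natr_acoef_y k : (0 < k)%N -> k%:R * acoef [:: Ly] k = 1.
Proof. by move=> k0; rewrite acoef_y divff // pnatr_eq0 -lt0n. Qed.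

(** Apply z d/dz to L_y L_w, that is, multiply the coefficients by m. The derivative of L_y is z /
    (1 - z) and gives a prefix sum; that of L_w removes its first letter and leaves the product for
    a shorter word. A leading y in front of w would add a term in tau, since it is no longer the
    last letter: the corrections through [rho] remove this term. *)
Lemma acoefl_ly_tshuffle_word w m : h1word w ->
  acoefl (tshuffle_word [:: Ly] w) m = convol (acoef [:: Ly]) (acoef w) m.
Proof.
elim: w m => [|b v IH] m hw.
  rewrite tshuffle_wordw1 acoefl_mon convol_rev /convol big_ord_recl acoef0 mul1r subn0.
  by rewrite big1 ?addr0 // => i _; rewrite acoef_nil mul0r.
have {}IH m' := IH m' (h1word_cons hw).
have aT : acoefl (tshuffle_word [:: Ly] (b :: v)) m =
    (\sum_(j < m) acoef (b :: v) j + tau * acoef (b :: v) m) / m%:R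
    + acoefl (mon [:: b] * tshuffle_word [:: Ly] v) m
    - 1 * (tau * (acoef (b :: v) m / m%:R))
    - (v == [::])%:R * acoefl (rho b * mon [:: Ly]) m.
  rewrite tshuffle_word_cons [LHS]wlin_combB.
  congr (_ + _ - _ * _ - _ * _).
  - rewrite tshuffle_word1w [LHS]acoefl_ly acoefl_mon.
    by congr ((_ + _) / _); apply: eq_bigr => j _; rewrite acoefl_mon.
  - exact: cev_delta.
  - by rewrite [LHS]acoefl_rho_ly acoefl_mon.
  - exact: cev_delta.
have a0 : acoefl (tshuffle_word [:: Ly] v) 0 = 0.
  by rewrite IH /convol big_ord_recl big_ord0 addr0 acoef0 mul0r.
have [m0|m0] := posnP m.
  rewrite m0 in aT *; rewrite aT.
  have -> : convol (acoef [:: Ly]) (acoef (b :: v)) 0 = 0.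
    by rewrite /convol big_ord_recl big_ord0 addr0 acoef0 mul0r.
  have r0 : acoefl (rho b * mon [:: Ly]) 0 = 0.
    by case: (b); [exact: acoefl_rho_lx|rewrite acoefl_rho_ly invr0 !mulr0].
  rewrite [X in _ - _ * X]r0 [X in _ + X - _ - _]acoefl_mon_cons0 [0%:R]mulr0n invr0.
  by ring.
apply: (mulfI (_ : m%:R != 0)); first by rewrite pnatr_eq0 -lt0n.
have lE : convol (fun i => i%:R * acoef [:: Ly] i) (acoef (b :: v)) m =
    \sum_(j < m) acoef (b :: v) j.
  rewrite convol_rev /convol big_ord_recr /= subnn mul0r mulr0 addr0.
  apply: eq_bigr => i _; have := @natr_acoef_y (m - i)%N.
  by rewrite subn_gt0 => /(_ (ltn_ord i)) /= ->; rewrite mulr1.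
rewrite convol_leibniz lE aT.
have n0 : m%:R != 0 :> R by rewrite pnatr_eq0 -lt0n.
have [v0|v0] := eqVneq v [::].
  rewrite v0 in hw aT lE *; case: b hw aT lE => // hw aT lE.
  rewrite tshuffle_wordw1 [X in _ + X - _ - _]acoefl_ly [X in _ - _ * X]acoefl_rho_ly.
  rewrite acoefl_mon mulr1n.
  have -> : convol (acoef [:: Ly]) (fun i => i%:R * acoef [:: Ly] i) m =
      \sum_(j < m) acoef [:: Ly] j.
    rewrite /convol big_ord_recr /= subnn mul0r mulr0 addr0.
    apply: eq_bigr => i _; have := @natr_acoef_y (m - i)%N.
    by rewrite subn_gt0 => /(_ (ltn_ord i)) /= ->; rewrite mulr1.
  have -> : \sum_(j < m) acoefl (mon [:: Ly]) j = \sum_(j < m) acoef [:: Ly] j.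
    by apply: eq_bigr => j _; rewrite acoefl_mon.
  by field.
rewrite mulr0n mul0r subr0.
(* Multiplying [acoef (b :: v)] by its index undoes the division except at index 0, where division
   by 0 yields 0; the other side vanishes there too because v is nonempty. *)
have -> : convol (acoef [:: Ly]) (fun i => i%:R * acoef (b :: v) i) m =
   m%:R * acoefl (mon [:: b] * tshuffle_word [:: Ly] v) m.
  case: (b).
    rewrite acoefl_lx IH mulrC divfK //; apply: eq_bigr => i _; congr (_ * _).
    case: (m - i)%N => [|k]; first by rewrite mul0r acoef0 (negbTE v0).
    by rewrite /= mulrC divfK // pnatr_eq0.
  rewrite acoefl_ly mulrC divfK // IH.
  have -> : \sum_(j < m) acoefl (tshuffle_word [:: Ly] v) j =
    \sum_(j < m) convol (acoef [:: Ly]) (acoef v) j by apply: eq_bigr => j _.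
  rewrite -convol_prefix /convol mulr_sumr -big_split; apply: eq_bigr => i _ /=.
  case: (m - i)%N => [|k]; first by rewrite big_ord0 mul0r acoef0 (negbTE v0) !mulr0 addr0.
  by rewrite [in LHS](mulrC k.+1%:R) divfK ?pnatr_eq0 //; ring.
by field.
Qed.

End TauCoefficients.

Local Open Scope classical_set_scope.

(** * Series and Abel means *)

Section Series.
Variable R : realType.
Implicit Types (a b s : nat -> R) (l z : R).

Definition sums a : nat -> R := fun n => \sum_(i < n) a i.

Lemma sumsS a n : sums a n.+1 = sums a n + a n.
Proof. by rewrite /sums big_ord_recr. Qed.

Lemma sums0 a : sums a 0 = 0.
Proof. by rewrite /sums big_ord0. Qed.

Lemma sums_series a : sums a = series a.
Proof. by apply/funext => n; rewrite /sums seriesEord. Qed.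

Lemma sums_ge0 a n : (forall i, 0 <= a i) -> 0 <= sums a n.
Proof. by move=> a0; apply: sumr_ge0. Qed.

Lemma sums_nd a : (forall i, 0 <= a i) -> nondecreasing_seq (sums a).
Proof. by move=> a0; apply/nondecreasing_seqP => n; rewrite sumsS lerDl. Qed.

Lemma sums_is_cvg a (M : R) : (forall i, 0 <= a i) -> (forall n, sums a n <= M) ->
  cvgn (sums a).
Proof.
move=> a0 aM; apply: nondecreasing_is_cvgn; first exact: sums_nd.
by exists M => _ [n _ <-].
Qed.

Lemma sums_le_lim a n : (forall i, 0 <= a i) -> cvgn (sums a) ->
  sums a n <= limn (sums a).
Proof. by move=> a0 ca; exact: (nondecreasing_cvgn_le (sums_nd a0) ca n). Qed.

Lemma cvg_double l a : a @ \oo --> l -> (fun n => a (n + n)%N) @ \oo --> l.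
Proof.
move=> al; have -> : (fun n => a (n + n)%N) = a \o muln 2.
  by apply/funext => n /=; rewrite mul2n addnn.
by apply: cvg_comp al; apply: cvg_mulnl.
Qed.

(** With nonnegative terms, the n by n square of products a_i b_j lies between the triangles i + j <
    n and i + j < 2n, so both kinds of partial sums have the same limit. *)
Lemma sums_convol_cvg a b : (forall i, 0 <= a i) -> (forall i, 0 <= b i) ->
  cvgn (sums a) -> cvgn (sums b) ->
  sums (convol a b) @ \oo --> limn (sums a) * limn (sums b).
Proof.
move=> a0 b0 ca cb.
have c0 m : 0 <= convol a b m by apply: sumr_ge0 => i _; apply: mulr_ge0.
have cE n : sums (convol a b) n = \sum_(i < n.+1) a i * sums b (n - i)%N.
  by rewrite -[RHS]/(convol a (fun i => \sum_(j < i) b j) n) convol_prefix.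
have up n : sums (convol a b) n <= sums a n * sums b n.
  rewrite cE big_ord_recr /= subnn [sums b 0]big_ord0 mulr0 addr0.
  rewrite /sums mulr_suml; apply: ler_sum => i _; apply: ler_wpM2l => //.
  by apply: sums_nd => //; apply: leq_subr.
have lo n : sums a n * sums b n <= sums (convol a b) (n + n)%N.
  rewrite cE -addnS big_split_ord /= /sums mulr_suml -[leLHS]addr0; apply: lerD.
    apply: ler_sum => i _; apply: ler_wpM2l => //; apply: sums_nd => //.
    by rewrite -addnBA ?leq_addr // ltnW.
  by apply: sumr_ge0 => i _; apply: mulr_ge0 => //; apply: sums_ge0.
have cab : (fun n => sums a n * sums b n) @ \oo --> limn (sums a) * limn (sums b).
  exact: cvgM.
have cc : cvgn (sums (convol a b)).
  apply: (@sums_is_cvg _ (limn (sums a) * limn (sums b))) => // n.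
  apply: (le_trans (up n)); apply: ler_pM; rewrite ?sums_ge0 // ; exact: sums_le_lim.
suff <- : limn (sums (convol a b)) = limn (sums a) * limn (sums b) by [].
apply/esym; move/cvg_lim: cab => <- //.
apply: cvg_lim => //.
apply: (squeeze_cvgr _ cc (cvg_double cc)).
by near=> n; rewrite up lo.
Unshelve. all: by end_near. Qed.


Lemma sums_geometric z : 0 <= z < 1 ->
  sums (fun m => 1 * z ^+ m) @ \oo --> (1 - z)^-1.
Proof.
move=> /andP[z0 z1]; rewrite sums_series -[(1 - z)^-1]mul1r.
by apply: cvg_geometric_series; rewrite ger0_norm.
Qed.

Definition psum a z := limn (sums (fun m => a m * z ^+ m)).

Lemma convol_psum a b z : 0 <= z ->
  (forall i, 0 <= a i) -> (forall i, 0 <= b i) ->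
  cvgn (sums (fun m => a m * z ^+ m)) -> cvgn (sums (fun m => b m * z ^+ m)) ->
  sums (fun m => convol a b m * z ^+ m) @ \oo --> psum a z * psum b z.
Proof.
move=> z0 a0 b0 ca cb.
have -> : (fun m => convol a b m * z ^+ m) =
    convol (fun m => a m * z ^+ m) (fun m => b m * z ^+ m).
  apply/funext => m; rewrite /convol mulr_suml; apply: eq_bigr => i _.
  have -> : z ^+ m = z ^+ i * z ^+ (m - i) by rewrite -exprD subnKC // -ltnS.
  by ring.
by apply: sums_convol_cvg => // i; apply: mulr_ge0; rewrite ?exprn_ge0.
Qed.

Lemma prefix_psum a z : 0 <= z < 1 -> (forall i, 0 <= a i) ->
  cvgn (sums (fun m => a m * z ^+ m)) ->
  sums (fun m => sums a m.+1 * z ^+ m) @ \oo --> psum a z * (1 - z)^-1.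
Proof.
move=> z01 a0 ca; have /andP[z0 _] := z01; have cg := sums_geometric z01.
have -> : (1 - z)^-1 = psum (fun=> 1) z by apply/esym/cvg_lim.
have -> : (fun m => sums a m.+1 * z ^+ m) = (fun m => convol a (fun=> 1) m * z ^+ m).
  by apply/funext => m; rewrite convol_geo.
by apply: convol_psum => //; apply/cvg_ex; eexists; exact: cg.
Qed.

(** Since 1 / (1 - z) = n + 2 at this point, L_y(z) = - log (1 - z) stays at bounded distance from
    the harmonic number H_n = S_y(n). *)
Definition zpt (n : nat) : R := 1 - n.+2%:R^-1.

Lemma zpt01 n : 0 <= zpt n < 1.
Proof.
rewrite /zpt subr_ge0 invf_le1 ?ltr0n // ler1n /=.
by rewrite ltrBlDr ltrDl invr_gt0 ltr0n.
Qed.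

Lemma sub1_zpt n : 1 - zpt n = n.+2%:R^-1.
Proof. by rewrite /zpt subKr. Qed.

(** The weights (1 - z) z^m sum to 1. The finitely many terms before m0 cost at most B, the sum of
    the |s_m - K|, because z^m <= 1, and the factor 1 - z makes this cost tend to 0. *)
Lemma abel_mean_ge s (K : R) (G : nat -> R) (eps : R) :
  (forall n, sums (fun m => s m * zpt n ^+ m) @ \oo --> G n) ->
  (\forall m \near \oo, K <= s m) -> 0 < eps ->
  \forall n \near \oo, K - eps <= (1 - zpt n) * G n.
Proof.
move=> sG [m0 _ Ks] e0.
pose B := \sum_(m < m0) `|s m - K|.
have GB n : - B <= G n - K * (1 - zpt n)^-1.
  have zn := zpt01 n; have /andP[z0 z1] := zn.
  have c : sums (fun m => (s m - K) * zpt n ^+ m) @ \oo --> G n - K * (1 - zpt n)^-1.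
    have -> : sums (fun m => (s m - K) * zpt n ^+ m) =
        (fun k => sums (fun m => s m * zpt n ^+ m) k - K * sums (fun m => 1 * zpt n ^+ m) k).
      apply/funext => k; rewrite /sums mulr_sumr -sumrB; apply: eq_bigr => i _.
      by ring.
    by apply: cvgB => //; apply: cvgM; [exact: cvg_cst|exact: sums_geometric].
  apply: (cvgr_to_ge c); exists m0 => // k /= /subnKC <-.
  rewrite /sums big_split_ord /= -[leLHS]addr0; apply: lerD.
    rewrite /B -sumrN; apply: ler_sum => i _.
    rewrite lerNl -mulNr (le_trans _ (_ : `|s i - K| * 1 <= _)) ?mulr1 //.
    apply: (le_trans (ler_norm _)); rewrite normrM normrN ger0_norm ?exprn_ge0 //.
    rewrite -[leRHS]mulr1; apply: ler_wpM2l => //; apply: exprn_ile1 => //; exact: ltW.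
  apply: sumr_ge0 => i _; apply: mulr_ge0; rewrite ?exprn_ge0 // subr_ge0.
  by apply: Ks; rewrite /= leq_addr.
have [N _ HN] : \forall n \near \oo, B * @harmonic R n <= eps.
  have /cvgrPdist_le/(_ _ e0) : B * @harmonic R n @[n --> \oo] --> B * 0.
    by apply: cvgM; [exact: cvg_cst|exact: cvg_harmonic].
  apply: filterS => n; rewrite mulr0 sub0r normrN; apply: le_trans; exact: ler_norm.
exists N => // n /= /HN {}HN; have := GB n; rewrite lerBrDr => Gn.
have p0 : 0 <= 1 - zpt n by rewrite sub1_zpt invr_ge0.
apply: le_trans (ler_wpM2l p0 Gn); rewrite mulrDr mulrCA divff; last first.
  by rewrite sub1_zpt invr_eq0 pnatr_eq0.
rewrite mulr1 mulrN addrC lerD2r lerN2 mulrC; apply: le_trans HN.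
apply: ler_wpM2l; first exact: sumr_ge0.
by rewrite sub1_zpt /harmonic lef_pV2 ?posrE ?ltr0n // ler_nat.
Qed.

End Series.

(** * Growth of harmonic numbers *)

Section LogarithmicGrowth.
Variable R : realType.

(** An elementary stand-in for log n. The added 1 keeps it at least 1, so that it can be inverted at
    every n. *)
Definition hlog (n : nat) : R := 1 + \sum_(i < n) i.+1%:R^-1.

Lemma hlogS n : hlog n.+1 = hlog n + n.+1%:R^-1.
Proof. by rewrite /hlog big_ord_recr /= addrA. Qed.

Lemma hlog0 : hlog 0 = 1.
Proof. by rewrite /hlog big_ord0 addr0. Qed.

Lemma hlog_nd : nondecreasing_seq hlog.
Proof. by apply/nondecreasing_seqP => n; rewrite hlogS lerDl invr_ge0. Qed.

Lemma hlog_ge1 n : 1 <= hlog n.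
Proof. by rewrite -hlog0; apply: hlog_nd. Qed.

Lemma hlog_ge0 n : 0 <= hlog n.
Proof. exact: le_trans (hlog_ge1 n). Qed.

Lemma hlogX_ge0 n J : 0 <= hlog n ^+ J.
Proof. by rewrite exprn_ge0 ?hlog_ge0. Qed.

Lemma hlog_cvgy : hlog @ \oo --> +oo.
Proof.
apply: nondecreasing_dvgn_lt; first exact: hlog_nd.
move=> ch; apply: (@dvg_harmonic R).
have -> : series (@harmonic R) = fun n => hlog n - 1.
  by apply/funext => n; rewrite seriesEord /hlog addrC addKr.
by apply: is_cvgB => //; exact: is_cvg_cst.
Qed.

Lemma sum_invn n : \sum_(m < n.+1) (m%:R^-1 : R) = hlog n - 1.
Proof. by rewrite big_ord_recl invr0 add0r /hlog addrC addKr. Qed.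

Definition logterm (J m : nat) : R := hlog m ^+ J / m%:R ^+ 2.

Lemma logterm_ge0 J m : 0 <= logterm J m.
Proof. by rewrite divr_ge0 ?hlogX_ge0 ?exprn_ge0. Qed.

Lemma exprB_le (x y : R) J : 0 <= x -> x <= y ->
  y ^+ J - x ^+ J <= J%:R * y ^+ J.-1 * (y - x).
Proof.
move=> x0 xy; have y0 := le_trans x0 xy.
rewrite subrXX mulrC; apply: ler_wpM2r; first by rewrite subr_ge0.
have -> : J%:R * y ^+ J.-1 = \sum_(i < J) y ^+ J.-1.
  by rewrite sumr_const card_ord mulr_natl.
apply: ler_sum => i _; case: J i => [[]//|J] i.
have -> : y ^+ J.+1.-1 = y ^+ (J - i) * y ^+ i by rewrite -exprD subnK // -ltnS.
by apply: ler_wpM2l; [exact: exprn_ge0|apply: lerXn2r].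
Qed.

(* Summation by parts against 1/(m(m+1)) lowers the exponent J by one. *)
Lemma logterm_bounded J : exists2 K : R, 0 <= K &
  forall N, sums (logterm J) N.+1 <= K /\ hlog N ^+ J / N.+1%:R <= K.
Proof.
pose t J m : R := hlog m ^+ J / (m%:R * m.+1%:R).
have t0 J' m : 0 <= t J' m by rewrite divr_ge0 ?hlogX_ge0 // mulr_ge0.
have parts J' N : sums (t J') N.+1 + hlog N ^+ J' / N.+1%:R <=
    1 + J'%:R * sums (logterm J'.-1) N.+1.
  elim: N => [|N IH].
    rewrite !sumsS !sums0 /t /logterm hlog0 !expr1n mul0r expr0n /= invr0 invr1.
    rewrite !(mulr0, mulr1, addr0, add0r, mul0r).
    exact: lexx.
  rewrite sumsS [sums (logterm _) _]sumsS mulrDr addrA.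
  have -> : sums (t J') N.+1 + t J' N.+1 + hlog N.+1 ^+ J' / N.+2%:R =
     (sums (t J') N.+1 + hlog N ^+ J' / N.+1%:R) + (hlog N.+1 ^+ J' - hlog N ^+ J') / N.+1%:R.
    have key (p a b x y : R) : x != 0 -> y != 0 -> y = x + 1 ->
        p + a / (x * y) + a / y = p + b / x + (a - b) / x.
      by move=> x0 y0 e; rewrite e in y0 *; field; rewrite x0 y0.
    by apply: key; rewrite ?pnatr_eq0 // natr1.
  apply: lerD => //.
  have hS : hlog N.+1 - hlog N = N.+1%:R^-1 by rewrite hlogS addrC addKr.
  have := exprB_le J' (hlog_ge0 N) (hlog_nd (leqnSn N)); rewrite hS => le.
  rewrite /logterm expr2 invfM !mulrA; apply: ler_wpM2r => //.
  by rewrite invr_ge0.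
suff step J' (K : R) : 0 <= K -> (forall N, 1 + J'%:R * sums (logterm J'.-1) N.+1 <= K) ->
    exists2 K : R, 0 <= K &
      forall N, sums (logterm J') N.+1 <= K /\ hlog N ^+ J' / N.+1%:R <= K.
  elim: J => [|J [K K0 HK]]; first by apply: (@step 0 1) => // N; rewrite mul0r addr0.
  apply: (@step J.+1 (1 + J.+1%:R * K)) => [|N]; first by rewrite addr_ge0 ?mulr_ge0.
  by rewrite lerD2l ler_wpM2l // (HK N).1.
move=> K0 HK; exists (K + K) => [|N]; first exact: addr_ge0.
have PN := le_trans (parts J' N) (HK N).
have h0 : 0 <= hlog N ^+ J' / N.+1%:R by rewrite divr_ge0 ?hlogX_ge0.
have s0 := sums_ge0 N.+1 (t0 J').
(* Since m + 1 <= 2m, 1/m^2 is at most twice 1/(m(m+1)); hence the constant K + K. *)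
have lt : sums (logterm J') N.+1 <= sums (t J') N.+1 + sums (t J') N.+1.
  rewrite /sums -big_split; apply: ler_sum => i _ /=.
  case: (nat_of_ord i) => [|m]; first by rewrite /logterm /t mul0r expr0n /= !invr0 !mulr0 addr0.
  rewrite /logterm /t -mulrDr; apply: ler_wpM2l; first exact: hlogX_ge0.
  have le : (m.+1%:R * (2 * m.+1%:R))^-1 <= (m.+1%:R * m.+2%:R)^-1 :> R.
    rewrite lef_pV2 ?posrE ?mulr_gt0 ?ltr0n //; apply: ler_wpM2l => //.
    by rewrite -natrM ler_nat; lia.
  have e : (m.+1%:R * (2 * m.+1%:R))^-1 = (m.+1%:R ^+ 2)^-1 / 2 :> R.
    by rewrite mulrCA -expr2 invfM mulrC.
  have half (p q : R) : p / 2 <= q -> p <= q + q by lra.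
  by apply: half; rewrite -e; exact: le.
have fin (p q x y : R) : 0 <= p -> 0 <= q -> p + q <= y -> x <= p + p ->
    x <= y + y /\ q <= y + y by split; lra.
exact: fin s0 h0 PN lt.
Qed.

Lemma logterm_cvg J : cvgn (sums (logterm J)).
Proof.
have [K _ HK] := logterm_bounded J; apply: (@sums_is_cvg _ _ K) => [m|[|n]].
- exact: logterm_ge0.
- by apply: le_trans (HK 0%N).1; apply: sums_nd => // m; apply: logterm_ge0.
- exact: (HK n).1.
Qed.

Lemma inv_hlog_cvg0 : (fun n => (hlog n)^-1) @ \oo --> 0.
Proof.
apply/gtr0_cvgV0; last exact: hlog_cvgy.
by near=> n; apply: lt_le_trans (hlog_ge1 n).
Unshelve. all: by end_near. Qed.

(** The boundary term of the summation by parts is bounded for the exponent J+1; dividing it by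
    [hlog n] gains the decay. *)
Lemma hlogX_div_cvg0 J : (fun n => hlog n ^+ J / n.+1%:R) @ \oo --> 0.
Proof.
have [K _ HK] := logterm_bounded J.+1.
have cK : (fun n => K * (hlog n)^-1) @ \oo --> 0.
  by rewrite -[0](mulr0 K); apply: cvgM; [exact: cvg_cst|exact: inv_hlog_cvg0].
apply: (squeeze_cvgr _ (cvg_cst 0) cK); near=> n.
have h0 : 0 < hlog n := lt_le_trans ltr01 (hlog_ge1 n).
rewrite divr_ge0 ?hlogX_ge0 //= ler_pdivlMr //.
by have := (HK n).2; rewrite exprSr mulrAC.
Unshelve. all: by end_near. Qed.


Section Rates.
Variables (a : nat -> R) (C : R) (J : nat).
Hypotheses (a0 : forall m, 0 <= a m) (aC : forall m, a m <= C * logterm J m).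

Let C0 : 0 <= C.
Proof.
have := le_trans (a0 1) (aC 1).
by rewrite pmulr_lge0 // /logterm divr_gt0 ?exprn_gt0 ?ltr0n // (lt_le_trans ltr01) ?hlog_ge1.
Qed.

Lemma rate_cvg : cvgn (sums a).
Proof.
apply: (@sums_is_cvg _ _ (C * limn (sums (logterm J)))) => // n.
apply: (le_trans (_ : _ <= C * sums (logterm J) n)).
  by rewrite /sums mulr_sumr; apply: ler_sum => i _.
apply: ler_wpM2l => //; apply: sums_le_lim; [exact: logterm_ge0|exact: logterm_cvg].
Qed.

Let l := limn (sums a).

(** In the tail m > N, the factor [hlog N ^+ j] is at most [hlog m ^+ j] and can be moved under the
    sum: what remains is a tail of the convergent series of [logterm (J + j)]. *)
Lemma rate_sums j : (fun N => (l - sums a N.+1) * hlog N ^+ j) @ \oo --> 0.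
Proof.
pose u := logterm (J + j); pose U := limn (sums u).
have cu : sums u @ \oo --> U by exact: logterm_cvg.
have step N k : (sums a (N.+1 + k)%N - sums a N.+1) * hlog N ^+ j <=
    C * (sums u (N.+1 + k)%N - sums u N.+1).
  elim: k => [|k IH]; first by rewrite addn0 !subrr mul0r mulr0 lexx.
  rewrite addnS [sums a _.+1]sumsS [sums u (_ + _)%N.+1]sumsS.
  have e (x y z : R) : x + y - z = (x - z) + y by ring.
  rewrite !e mulrDl mulrDr; apply: lerD => //.
  apply: (le_trans (ler_wpM2r (hlogX_ge0 N j) (aC _))).
  rewrite -mulrA; apply: ler_wpM2l => //; rewrite /u /logterm mulrAC exprD.
  apply: ler_wpM2r; first by rewrite invr_ge0 exprn_ge0.
  apply: ler_wpM2l; first exact: hlogX_ge0.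
  apply: lerXn2r; rewrite ?nnegrE ?hlog_ge0 //; apply: hlog_nd.
  by rewrite addSn ltnW // ltnS leq_addr.
have up N : (l - sums a N.+1) * hlog N ^+ j <= C * (U - sums u N.+1).
  have ca : (fun n => (sums a n - sums a N.+1) * hlog N ^+ j) @ \oo -->
      (l - sums a N.+1) * hlog N ^+ j.
    apply: cvgM; last exact: cvg_cst.
    by apply: cvgB; [exact: rate_cvg|exact: cvg_cst].
  have cU : (fun n => C * (sums u n - sums u N.+1)) @ \oo --> C * (U - sums u N.+1).
    apply: cvgM; first exact: cvg_cst.
    by apply: cvgB; [exact: cu|exact: cvg_cst].
  apply: (ler_cvg_to ca cU); exists N.+1 => // n /= /subnKC <-; exact: step.
have c0 : (fun N => C * (U - sums u N.+1)) @ \oo --> 0.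
  rewrite -[0](mulr0 C) -(subrr U); apply: cvgM; first exact: cvg_cst.
  apply: cvgB; first exact: cvg_cst.
  by have := cu; rewrite -cvg_shiftS.
apply: (squeeze_cvgr _ (cvg_cst 0) c0); near=> N.
rewrite up andbT mulr_ge0 ?hlogX_ge0 // subr_ge0.
by apply: sums_le_lim => //; exact: rate_cvg.
Unshelve. all: by end_near. Qed.

Lemma rate_summable n : cvgn (sums (fun m => a m * zpt R n ^+ m)).
Proof.
have /andP[z0 z1] := zpt01 R n.
apply: (@sums_is_cvg _ _ l) => [m|N]; first by rewrite mulr_ge0 ?exprn_ge0.
apply: (le_trans _ (sums_le_lim N a0 rate_cvg)); apply: ler_sum => i _.
by rewrite -[leRHS]mulr1; apply: ler_wpM2l => //; rewrite exprn_ile1 // ltW.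
Qed.

(** Bernoulli's inequality 1 - z^m <= m (1 - z). *)
Lemma expr_zpt_ge n m : 1 - zpt R n ^+ m <= m%:R / n.+2%:R.
Proof.
have /andP[z0 z1] := zpt01 R n.
elim: m => [|m IH]; first by rewrite expr0 subrr mul0r.
have -> : m.+1%:R / n.+2%:R = m%:R / n.+2%:R + (1 - zpt R n).
  by rewrite sub1_zpt -[m.+1%:R]natr1 mulrDl mul1r.
rewrite exprS.
have -> : 1 - zpt R n * zpt R n ^+ m = zpt R n * (1 - zpt R n ^+ m) + (1 - zpt R n) by ring.
rewrite lerD2r; apply: le_trans IH; rewrite -[leRHS]mul1r; apply: ler_wpM2r; last exact: ltW.
by rewrite subr_ge0 exprn_ile1 // ltW.
Qed.

(* 1 - z_n^m <= m / (n+2) for the first n terms, and 1 - z_n^m <= 1 for the others. *)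
Lemma rate_psum j : (fun n => (l - psum a (zpt R n)) * hlog n ^+ j) @ \oo --> 0.
Proof.
have lo n : psum a (zpt R n) <= l.
  have /andP[z0 z1] := zpt01 R n.
  apply: (ler_cvg_to (rate_summable (n:=n)) rate_cvg); near=> N; apply: ler_sum => i _.
  by rewrite -[leRHS]mulr1; apply: ler_wpM2l => //; rewrite exprn_ile1 // ltW.
have up n : l - psum a (zpt R n) <= C * (hlog n ^+ J.+1 / n.+1%:R) + (l - sums a n.+1).
  have /andP[z0 z1] := zpt01 R n.
  have c : (fun N => sums a N - sums (fun m => a m * zpt R n ^+ m) N) @ \oo -->
      l - psum a (zpt R n).
    by apply: cvgB; [exact: rate_cvg|exact: rate_summable].
  apply: (cvgr_to_le c); exists n.+1 => // N /= /subnKC <-.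
  set k := (N - _)%N; rewrite /sums -sumrB big_split_ord /=; apply: lerD.
    (* The factor m of Bernoulli's inequality cancels one of the two m in the denominator of
       [logterm]; a harmonic sum remains, at the price of one more logarithm. *)
    apply: (le_trans (_ : _ <= \sum_(i < n.+1) (C * hlog n ^+ J / n.+2%:R) * i%:R^-1)).
      apply: ler_sum => i _; rewrite -{1}[a i]mulr1 -mulrBr.
      apply: (le_trans (ler_pM _ _ (aC i) (expr_zpt_ge n i))) => //.
        by rewrite subr_ge0 exprn_ile1 // ltW.
      case: (nat_of_ord i) (ltn_ord i) => [|m] mn; first by rewrite mul0r !mulr0 invr0 mulr0.
      have -> : C * logterm J m.+1 * (m.+1%:R / n.+2%:R) =
          C * hlog m.+1 ^+ J / n.+2%:R * m.+1%:R^-1.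
        rewrite /logterm; have m0 : m.+1%:R != 0 :> R by rewrite pnatr_eq0.
        have n0 : n.+2%:R != 0 :> R by rewrite pnatr_eq0.
        have key (x y p q : R) : x != 0 -> y != 0 -> p * (q / x ^+ 2) * (x / y) = p * q / y * x^-1.
          by move=> x0 y0; field; rewrite x0 y0.
        exact: key.
      apply: ler_wpM2r; first by rewrite invr_ge0.
      apply: ler_wpM2r; first by rewrite invr_ge0.
      apply: ler_wpM2l => //; apply: lerXn2r; rewrite ?nnegrE ?hlog_ge0 //.
      by apply: hlog_nd; rewrite -ltnS.
    rewrite -mulr_sumr sum_invn exprSr -!mulrA; apply: ler_wpM2l => //.
    apply: ler_wpM2l; first exact: hlogX_ge0.
    rewrite mulrC; apply: ler_pM; rewrite ?invr_ge0 ?subr_ge0 ?hlog_ge1 //.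
      by rewrite lerBlDr lerDl.
    by rewrite lef_pV2 ?posrE ?ltr0n // ler_nat.
  apply: (le_trans (_ : _ <= \sum_(i < k) a (n.+1 + i)%N)).
    apply: ler_sum => i _; rewrite lerBlDr lerDl; apply: mulr_ge0 => //; exact: exprn_ge0.
  rewrite lerBrDl; apply: le_trans (sums_le_lim (n.+1 + k) a0 rate_cvg).
  by rewrite /sums big_split_ord.
have c0 : (fun n => (C * (hlog n ^+ J.+1 / n.+1%:R) + (l - sums a n.+1)) * hlog n ^+ j)
    @ \oo --> 0.
  have -> : (fun n => (C * (hlog n ^+ J.+1 / n.+1%:R) + (l - sums a n.+1)) * hlog n ^+ j) =
     (fun n => C * (hlog n ^+ (J.+1 + j) / n.+1%:R) + (l - sums a n.+1) * hlog n ^+ j).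
    by apply/funext => n; rewrite exprD; ring.
  rewrite -[0]addr0; apply: cvgD; last exact: rate_sums.
  rewrite -[0](mulr0 C); apply: cvgM; [exact: cvg_cst|exact: hlogX_div_cvg0].
apply: (squeeze_cvgr _ (cvg_cst 0) c0); near=> n.
rewrite mulr_ge0 ?hlogX_ge0 ?subr_ge0 ?lo //=.
by apply: ler_wpM2r; [exact: hlogX_ge0|exact: up].
Unshelve. all: by end_near. Qed.

End Rates.

End LogarithmicGrowth.

(** * Polylogarithms *)

Section Polylogarithms.
Variables (R : realType) (tau : R).
Hypothesis tau0 : 0 <= tau.
Notation acoef := (@acoef R tau).
Notation ssum := (@ssum R tau).
Notation acoefl := (@acoefl R tau).
Notation ssuml := (@ssuml R tau).
Notation cevr := (@cevr R tau).

Lemma acoef_ge0 w m : 0 <= acoef w m.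
Proof.
elim: w m => [|[] w IH] m /=; first by rewrite ler0n.
  by rewrite divr_ge0.
by rewrite divr_ge0 // addr_ge0 ?mulr_ge0 // sumr_ge0.
Qed.

Lemma ssum_sums w m : ssum w m = sums (acoef w) m.+1.
Proof. by []. Qed.

Lemma ssum_ge0 w m : 0 <= ssum w m.
Proof. by apply: sumr_ge0 => i _; apply: acoef_ge0. Qed.

Lemma acoef_le_ssum w m : acoef w m <= ssum w m.
Proof.
by rewrite ssum_prefix lerDr; apply: sumr_ge0 => i _; apply: acoef_ge0.
Qed.

Lemma acoef_cons_le b v m : acoef (b :: v) m <= (1 + tau) * ssum v m / m%:R.
Proof.
have le : acoef v m <= ssum v m := acoef_le_ssum v m.
have a0 := acoef_ge0 v m; have s0 := ssum_ge0 v m.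
case: b => /=; apply: ler_wpM2r; rewrite ?invr_ge0 //.
  by apply: (le_trans le); rewrite mulrDl mul1r lerDl mulr_ge0.
rewrite mulrDl mul1r; apply: lerD; last exact: ler_wpM2l.
by rewrite ssum_prefix lerDl.
Qed.

Lemma ssum_le w N : ssum w N <= (1 + tau) ^+ size w * hlog R N ^+ size w.
Proof.
have t0 : 0 <= 1 + tau by rewrite addr_ge0.
elim: w N => [|b v IH] N; first by rewrite ssum_nil !expr0 mulr1 lexx.
apply: (le_trans (_ : _ <= \sum_(m < N.+1) ((1 + tau) * ssum v N) * m%:R^-1)).
  apply: ler_sum => m _; apply: (le_trans (acoef_cons_le _ _ _)).
  apply: ler_wpM2r; rewrite ?invr_ge0 //; apply: ler_wpM2l => //.
  by rewrite !ssum_sums; apply: sums_nd => //; exact: acoef_ge0.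
rewrite -mulr_sumr sum_invn /= !exprS -!mulrA; apply: ler_wpM2l => //.
rewrite [leRHS]mulrCA [leRHS]mulrC; apply: ler_pM; rewrite ?ssum_ge0 ?subr_ge0 ?hlog_ge1 //.
by rewrite lerBlDr lerDl.
Qed.

(** Each letter of v costs at most one logarithm, and the leading x supplies the second division by
    m: this is where h0 gets its domination by [logterm]. *)
Lemma acoef_lx_le b v m :
  acoef (Lx :: b :: v) m <= (1 + tau) ^+ (size v).+1 * logterm R (size v) m.
Proof.
have t0 : 0 <= 1 + tau by rewrite addr_ge0.
rewrite -[acoef _ m]/(acoef (b :: v) m / m%:R) /logterm expr2 invfM !mulrA.
apply: ler_wpM2r; rewrite ?invr_ge0 //; apply: (le_trans (acoef_cons_le _ _ _)).
apply: ler_wpM2r; rewrite ?invr_ge0 // exprS -mulrA; apply: ler_wpM2l => //.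
exact: ssum_le.
Qed.

(** By [acoef_cons_le] a new letter multiplies the series by at most (1 + tau) / (1 - z). *)
Lemma acoef_summable w z : 0 <= z < 1 -> cvgn (sums (fun m => acoef w m * z ^+ m)).
Proof.
move=> z01; have /andP[z0 z1] := z01.
have p0 v m : 0 <= acoef v m * z ^+ m by rewrite mulr_ge0 ?acoef_ge0 ?exprn_ge0.
elim: w => [|b v IH].
  apply: (@sums_is_cvg _ _ 1) => // -[|N]; first by rewrite sums0.
  rewrite /sums big_ord_recl big1 => [|i _]; first by rewrite expr0 mulr1 addr0.
  by rewrite acoef_nil mul0r.
have pc := prefix_psum z01 (acoef_ge0 v) IH.
have t0 : 0 <= 1 + tau by rewrite addr_ge0.
apply: (@sums_is_cvg _ _ ((1 + tau) * (psum (acoef v) z * (1 - z)^-1))) => // N.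
apply: (le_trans (_ : _ <= (1 + tau) * sums (fun m => ssum v m * z ^+ m) N)).
  rewrite /sums mulr_sumr; apply: ler_sum => i _; rewrite mulrA.
  apply: ler_wpM2r; first exact: exprn_ge0.
  apply: (le_trans (acoef_cons_le _ _ _)); have s0 := ssum_ge0 v i.
  case: (nat_of_ord i) => [|m]; first by rewrite invr0 mulr0 mulr_ge0 ?ssum_ge0.
  rewrite -[leRHS]mulr1; apply: ler_wpM2l; first by rewrite mulr_ge0 ?ssum_ge0.
  by rewrite invf_le1 ?ltr0n // ler1n.
apply: ler_wpM2l => //; have <- := cvg_lim (@norm_hausdorff _ _) pc.
apply: sums_le_lim => [m|]; first by rewrite mulr_ge0 ?exprn_ge0 ?ssum_ge0.
by apply/cvg_ex; eexists; exact: pc.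
Qed.

(** Sampled at [zpt n], so that polylogarithms and truncated sums are both sequences in n, with the
    same growth scale and a common abstract treatment. *)
Definition polylog (w : word) (n : nat) : R := psum (acoef w) (zpt R n).
Definition polylogl (f : ht) (n : nat) : R := wlin cevr (polylog^~ n) f.

Lemma polylogl_linear c f g n :
  polylogl (c *: f + g) n = cev tau c * polylogl f n + polylogl g n.
Proof. exact: wlin_linear. Qed.

Lemma polylogl_mon w n : polylogl (mon w) n = polylog w n.
Proof. exact: wlin_mon. Qed.

Lemma polylogl0 n : polylogl 0 n = 0. Proof. exact: wlin0. Qed.

Lemma sums_linear (x z : R) (a b c : nat -> R) (la lb : R) :
  (forall m, c m = x * a m + b m) ->
  sums (fun m => a m * z ^+ m) @ \oo --> la -> sums (fun m => b m * z ^+ m) @ \oo --> lb ->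
  sums (fun m => c m * z ^+ m) @ \oo --> x * la + lb.
Proof.
move=> cE ca cb; have -> : sums (fun m => c m * z ^+ m) = fun n =>
    x * sums (fun m => a m * z ^+ m) n + sums (fun m => b m * z ^+ m) n.
  apply/funext => n; rewrite /sums mulr_sumr -big_split; apply: eq_bigr => i _.
  by rewrite cE mulrDl mulrA.
by apply: cvgD => //; apply: cvgM => //; exact: cvg_cst.
Qed.

Lemma sums_zero (z : R) (c : nat -> R) : (forall m, c m = 0) ->
  sums (fun m => c m * z ^+ m) @ \oo --> 0.
Proof.
move=> c0; have -> : sums (fun m => c m * z ^+ m) = cst 0; last exact: cvg_cst.
by apply/funext => n; rewrite /sums big1 // => i _; rewrite c0 mul0r.
Qed.

Lemma polylogl_cvg f n :
  sums (fun m => acoefl f m * zpt R n ^+ m) @ \oo --> polylogl f n.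
Proof.
apply: (@ht_ind (fun f =>
  sums (fun m => acoefl f m * zpt R n ^+ m) @ \oo --> polylogl f n)) => [|w].
  split=> [|c g h Hg Hh].
    by rewrite polylogl0; apply: sums_zero => m; rewrite acoefl0.
  rewrite polylogl_linear; apply: sums_linear Hg Hh => m; exact: acoefl_linear.
rewrite polylogl_mon; under [X in sums X]eq_fun do rewrite acoefl_mon.
by apply: acoef_summable; apply: zpt01.
Qed.

(** Identifies the series with coefficients [acoefl f] as the Abel mean of the partial sums
    [ssuml f]. *)
Lemma ssuml_cvg f n :
  sums (fun m => ssuml f m * zpt R n ^+ m) @ \oo --> polylogl f n * (1 - zpt R n)^-1.
Proof.
apply: (@ht_ind (fun f => sums (fun m => ssuml f m * zpt R n ^+ m) @ \oo -->
    polylogl f n * (1 - zpt R n)^-1)) => [|w].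
  split=> [|c g h Hg Hh].
    by rewrite polylogl0 mul0r; apply: sums_zero => m; rewrite /ssuml wlin0.
  rewrite polylogl_linear mulrDl -mulrA.
  apply: sums_linear Hg Hh => m; exact: ssuml_linear.
rewrite polylogl_mon; under [X in sums X]eq_fun do rewrite ssuml_mon.
apply: prefix_psum; [exact: zpt01|exact: acoef_ge0|].
by apply: acoef_summable; apply: zpt01.
Qed.

Lemma polylogl_ly_tshuffle f n : in_h1 f ->
  polylogl (tshuffle ly f) n = polylog [:: Ly] n * polylogl f n.
Proof.
rewrite in_h1P; apply: (@wspan_ind h1word (fun f =>
  polylogl (tshuffle ly f) n = polylog [:: Ly] n * polylogl f n)) => [|w hw].
  split=> [|c g h Hg Hh]; first by rewrite /tshuffle bilin_ext0r !polylogl0 mulr0.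
  rewrite /tshuffle bilin_extDr [LHS]polylogl_linear [X in _ * X + _]Hg [X in _ + X]Hh.
  by rewrite [X in _ = _ * X]polylogl_linear mulrDr mulrCA.
rewrite /tshuffle bilin_ext_mon polylogl_mon.
have zn := zpt01 R n; have /andP[z0 _] := zn.
have c1 := @polylogl_cvg (tshuffle_word [:: Ly] w) n.
have c2 := convol_psum z0 (acoef_ge0 [:: Ly]) (acoef_ge0 w)
  (@acoef_summable [:: Ly] _ zn) (@acoef_summable w _ zn).
rewrite -(cvg_lim (@norm_hausdorff _ _) c1) -(cvg_lim (@norm_hausdorff _ _) c2).
by congr (limn (sums _)); apply/funext => m; rewrite acoefl_ly_tshuffle_word.
Qed.

(** Below, the terms up to n lose at most (n+1) / (n+1) = 1 by Bernoulli's inequality, and [hlog]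
    itself exceeds their harmonic sum by 1. Above, the terms after n are at most 1/(n+1) times a
    geometric series of sum n+2, hence at most 2. *)
Lemma polylog_y_bounds n : hlog R n - 2 <= polylog [:: Ly] n <= hlog R n + 1.
Proof.
have zn := zpt01 R n; have /andP[z0 z1] := zn.
have cy := @acoef_summable [:: Ly] _ zn; apply/andP; split.
  apply: (le_trans _ (sums_le_lim n.+1 _ cy)) => [|m]; last first.
    by rewrite mulr_ge0 ?acoef_ge0 ?exprn_ge0.
  have -> : hlog R n - 2 =
      \sum_(m < n.+1) (m%:R^-1 : R) - \sum_(m < n.+1) (n.+1%:R^-1 : R).
    rewrite sum_invn sumr_const card_ord -[_ *+ n.+1]mulr_natr mulVf ?pnatr_eq0 //.
    by ring.
  rewrite /sums -sumrB; apply: ler_sum => m _; rewrite acoef_y lerBlDr -lerBlDl.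
  rewrite -[X in X - _]mulr1 -mulrBr.
  case: (nat_of_ord m) => [|k]; first by rewrite invr0 mul0r invr_ge0.
  rewrite ler_pdivrMl ?ltr0n //; apply: (le_trans (expr_zpt_ge R n k.+1)).
  by apply: ler_wpM2l => //; rewrite lef_pV2 ?posrE ?ltr0n // ler_nat.
have cg := sums_geometric zn.
apply: (cvgr_to_le cy); near=> N.
apply: (le_trans (_ : _ <= sums (fun m => acoef [:: Ly] m * zpt R n ^+ m) (n.+1 + N)%N)).
  apply: sums_nd; last by rewrite leq_addl.
  by move=> m; rewrite mulr_ge0 ?acoef_ge0 ?exprn_ge0.
rewrite /sums big_split_ord /=.
have -> : hlog R n + 1 = (hlog R n - 1) + 2 by ring.
apply: lerD.
  rewrite -sum_invn; apply: ler_sum => i _; rewrite -/(acoef [:: Ly] i) acoef_y.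
  by rewrite -[leRHS]mulr1; apply: ler_wpM2l; rewrite ?invr_ge0 // exprn_ile1 // ltW.
apply: (le_trans (_ : _ <= n.+1%:R^-1 * sums (fun m => 1 * zpt R n ^+ m) N)).
  rewrite /sums mulr_sumr; apply: ler_sum => i _.
  rewrite -/(acoef [:: Ly] (n.+1 + i)%N) acoef_y mul1r.
  apply: ler_pM; rewrite ?invr_ge0 ?exprn_ge0 //.
    by rewrite lef_pV2 ?posrE ?ltr0n // ler_nat leq_addr.
  by apply: ler_wiXn2l => //; [exact: ltW|exact: leq_addl].
rewrite ler_pdivrMl ?ltr0n //.
apply: (le_trans (_ : _ <= (1 - zpt R n)^-1)).
  rewrite -(cvg_lim (@norm_hausdorff _ _) cg); apply: sums_le_lim.
    by move=> m; rewrite mul1r exprn_ge0.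
  by apply/cvg_ex; eexists; exact: cg.
by rewrite sub1_zpt invrK -natrM ler_nat; lia.
Unshelve. all: by end_near. Qed.

End Polylogarithms.

(** * Values on h0 *)

Lemma boxings_cons k1 k : k != [::] -> boxings (k1 :: k) =
  [seq k1 :: p | p <- boxings k] ++ [seq (k1 + head 0 p)%N :: behead p | p <- boxings k].
Proof. by case: k. Qed.

Lemma boxings_size k p : p \in boxings k -> (size p <= size k)%N.
Proof.
elim: k p => [|k1 k IH] p; first by rewrite inE => /eqP ->.
have [->|k0] := eqVneq k [::]; first by rewrite inE => /eqP ->.
rewrite boxings_cons // mem_cat => /orP[] /mapP[q /IH qk ->] //=.
by rewrite ltnS size_behead (leq_trans (leq_pred _)).
Qed.

Lemma boxings_nil k p : k != [::] -> p \in boxings k -> p != [::].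
Proof.
case: k => // k1 k _; have [->|k0] := eqVneq k [::]; first by rewrite inE => /eqP ->.
by rewrite boxings_cons // mem_cat => /orP[] /mapP[q _ ->].
Qed.

Section TruncatedValues.
Variable R : realType.

Lemma mzv_trunc_ge0 k N : 0 <= mzv_trunc R k N.
Proof.
elim: k N => [|k1 k IH] N //=; apply: sumr_ge0 => m _.
by rewrite mulr_ge0 ?invr_ge0 ?exprn_ge0.
Qed.

Lemma mzv_trunc_nd k : nondecreasing_seq (mzv_trunc R k).
Proof.
case: k => [|k1 k] //=; apply/nondecreasing_seqP => -[|n].
  by rewrite !big_geq.
rewrite [leRHS]big_nat_recr //= lerDl mulr_ge0 ?mzv_trunc_ge0 //.
by rewrite invr_ge0 exprn_ge0.
Qed.

Section Tau.
Variable tau : R.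
Notation acoef := (@acoef R tau).
Notation ssum := (@ssum R tau).

(** In the recursion for z_{k1}, an inner index j < m is a comma and j = m, of weight tau, is a plus
    that adds the two exponents; the number of pluses is [size k - size p]. *)
Lemma acoef_boxings k m : k != [::] -> all (leq 1) k ->
  acoef (zword k) m.+1 = \sum_(p <- boxings k) tau ^+ (size k - size p) *
    (m.+1%:R ^- head 0%N p * mzv_trunc R (behead p) m.+1).
Proof.
elim: k m => [//|k1 k IH] m _ /andP[k10 kp]; rewrite acoef_zword //.
have [->|k0] := eqVneq k [::].
  by rewrite big_seq1 /= subnn expr0 mul1r mulr1 ssum_nil subr0 mulr0 addr0 mul1r.
rewrite boxings_cons // big_cat !big_map /=.
have -> : ssum (zword k) m.+1 - acoef (zword k) m.+1 =
    \sum_(p <- boxings k) tau ^+ (size k - size p) * mzv_trunc R p m.+1.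
  transitivity (\sum_(1 <= j < m.+1) acoef (zword k) j).
    rewrite ssum_prefix addrK -(big_mkord xpredT (acoef (zword k))) big_ltn //.
    by rewrite acoef0 zword_nil // (negbTE k0) add0r.
  rewrite big_add1 /=; under eq_bigr => j _ do rewrite IH //.
  rewrite exchange_big /= big_seq [RHS]big_seq; apply: eq_bigr => p pk.
  have := boxings_nil k0 pk; case: p pk => // p1 p _ _ /=.
  by rewrite -mulr_sumr big_add1.
rewrite IH // mulrDl; congr (_ + _).
  rewrite mulr_suml; apply: eq_bigr => p _; rewrite subSS.
  by rewrite -mulrA [X in _ * X]mulrC.
rewrite -mulrA mulr_suml mulr_sumr big_seq [RHS]big_seq; apply: eq_bigr => p pk.
(* The bound [sp] makes the subtraction exact, so that a plus raises the exponent of tau by one. *)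
have sp := boxings_size pk; have := boxings_nil k0 pk; case: p pk sp => // p1 p pk sp _ /=.
have -> : ((size k).+1 - (size p).+1 = (size k - (size p).+1).+1)%N by move: sp => /=; lia.
by rewrite exprS exprD invfM; ring.
Qed.

Lemma ssum_boxings k N : k != [::] -> all (leq 1) k ->
  ssum (zword k) N = \sum_(p <- boxings k) tau ^+ (size k - size p) * mzv_trunc R p N.+1.
Proof.
move=> k0 kp; rewrite /ssum big_ord_recl acoef0 zword_nil // (negbTE k0) add0r.
under eq_bigr => i _ do rewrite /= acoef_boxings //.
rewrite exchange_big /= big_seq [RHS]big_seq; apply: eq_bigr => p pk.
have := boxings_nil k0 pk; case: p pk => // p1 p _ _ /=.
by rewrite -mulr_sumr big_add1 /= big_mkord.
Qed.

End Tau.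

Lemma h0word_rate (tau : R) w : 0 <= tau -> h0word w -> w != [::] ->
  exists C J, forall m, acoef tau w m <= C * logterm R J m.
Proof.
move=> t0; case: w => [//|a [|b v]] /andP[hw /eqP /= xa] _; rewrite xa in hw *.
  by [].
by exists ((1 + tau) ^+ (size v).+1), (size v) => m; apply: acoef_lx_le.
Qed.

(** At tau = 1 every boxing has coefficient 1, so each truncated value is one of the nonnegative
    summands of the bounded sequence S_w. *)
Lemma mzv_cvg w p : h0word w -> w != [::] -> p \in boxings (index_of w) ->
  mzv_trunc R p @ \oo --> mzv R p.
Proof.
move=> hw w0 pw; have t0 := @ler01 R.
have [C [J aC]] := h0word_rate t0 hw w0.
have ca := rate_cvg (acoef_ge0 t0 w) aC.
apply: nondecreasing_is_cvgn; first exact: mzv_trunc_nd.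
exists (limn (sums (acoef 1 w))) => _ [n _ <-].
apply: (le_trans (mzv_trunc_nd p (leqnSn n))).
apply: (le_trans _ (sums_le_lim n.+1 (acoef_ge0 t0 w) ca)).
have hw1 : h1word w by case/andP: hw.
have k0 : index_of w != [::].
  by apply: contraNneq w0 => e; rewrite -(index_of_word hw1) e.
rewrite -[leRHS]/(ssum 1 w n) -(index_of_word hw1) ssum_boxings ?index_of_gt0 //.
rewrite (big_rem p pw) /= expr1n mul1r lerDl; apply: sumr_ge0 => q _.
by rewrite expr1n mul1r mzv_trunc_ge0.
Qed.

Lemma mzvt_limit (tau : R) w : 0 <= tau -> h0word w -> w != [::] ->
  (mzvt R (index_of w)).[tau] = limn (sums (acoef tau w)).
Proof.
move=> t0 hw w0; have hw1 : h1word w by case/andP: hw.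
have k0 : index_of w != [::].
  by apply: contraNneq w0 => e; rewrite -(index_of_word hw1) e.
pose S N (s : seq (seq nat)) :=
  \sum_(p <- s) tau ^+ (size (index_of w) - size p) * mzv_trunc R p N.
have cS s : {subset s <= boxings (index_of w)} -> (fun N => S N s) @ \oo -->
    \sum_(p <- s) tau ^+ (size (index_of w) - size p) * mzv R p.
  rewrite /S; elim: s => [|p s IH] sub.
    by rewrite big_nil; under eq_fun do rewrite big_nil; exact: cvg_cst.
  rewrite big_cons; under eq_fun do rewrite big_cons.
  apply: cvgD; last by apply: IH => q qs; apply: sub; rewrite inE qs orbT.
  apply: cvgM; first exact: cvg_cst.
  by apply: mzv_cvg hw w0 _; apply: sub; rewrite inE eqxx.
have := cS _ (fun p => id); rewrite -cvg_shiftS => c.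
have -> : (mzvt R (index_of w)).[tau] =
    \sum_(p <- boxings (index_of w)) tau ^+ (size (index_of w) - size p) * mzv R p.
  rewrite /mzvt horner_sum; apply: eq_bigr => p _.
  by rewrite hornerZ hornerXn mulrC.
have [C [J aC]] := h0word_rate t0 hw w0.
have ca := rate_cvg (acoef_ge0 t0 w) aC.
have := ca; rewrite -cvg_shiftS => ca'.
apply/esym/(cvg_unique _ ca') => //.
have e : (fun n => sums (acoef tau w) n.+1) = fun n => S n.+1 (boxings (index_of w)).
  apply/funext => n; rewrite -[LHS]/(ssum tau w n) -[in LHS](index_of_word hw1).
  by rewrite ssum_boxings ?index_of_gt0.
by rewrite /= e; exact: c.
Qed.

Lemma mzv_nil : mzv R [::] = 1.
Proof. by apply: cvg_lim => //; exact: cvg_cst. Qed.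

Lemma mzvt_nil (tau : R) : (mzvt R [::]).[tau] = 1.
Proof. by rewrite /mzvt big_seq1 hornerZ hornerXn mzv_nil mul1r. Qed.

Lemma polylog_nil (tau : R) n : polylog tau [::] n = 1.
Proof.
apply: cvg_lim => //; rewrite -cvg_shiftS.
have -> : [sequence sums (fun m => acoef tau [::] m * zpt R n ^+ m) N.+1]_N = cst 1.
  apply/funext => N; rewrite /= /sums big_ord_recl big1 => [|i _].
    by rewrite expr0 mulr1 addr0.
  by rewrite /= mulr0n mul0r.
exact: cvg_cst.
Qed.

Lemma ssum_h0_rate (tau : R) w j : 0 <= tau -> h0word w ->
  (fun n => ((mzvt R (index_of w)).[tau] - ssum tau w n) * hlog R n ^+ j) @ \oo --> 0.
Proof.
move=> t0 hw; have [->|w0] := eqVneq w [::].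
  rewrite mzvt_nil; under eq_fun do rewrite ssum_nil subrr mul0r; exact: cvg_cst.
have [C [J aC]] := h0word_rate t0 hw w0.
by rewrite mzvt_limit //; apply: (rate_sums (acoef_ge0 t0 w) aC).
Qed.

Lemma polylog_h0_rate (tau : R) w j : 0 <= tau -> h0word w ->
  (fun n => ((mzvt R (index_of w)).[tau] - polylog tau w n) * hlog R n ^+ j) @ \oo --> 0.
Proof.
move=> t0 hw; have [->|w0] := eqVneq w [::].
  rewrite mzvt_nil; under eq_fun do rewrite polylog_nil subrr mul0r; exact: cvg_cst.
have [C [J aC]] := h0word_rate t0 hw w0.
by rewrite mzvt_limit //; apply: (rate_psum (acoef_ge0 t0 w) aC).
Qed.

End TruncatedValues.

(** * Asymptotics on h1 *)

Lemma scale_invn_mulrn (V : lmodType {poly rat}) (x : V) k :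
  ((k.+1%:R^-1 : rat)%:P : {poly rat}) *: (x *+ k.+1) = x.
Proof.
rewrite -scaler_nat scalerA -polyC_natr -polyCM mulVf ?pnatr_eq0 //.
by rewrite scale1r.
Qed.

Section Specialization.
Variable R : realType.

Definition tspec (tau : R) (P : {poly {poly R}}) : {poly R} :=
  map_poly (horner_eval tau) P.

Lemma tspec0 tau : tspec tau 0 = 0.
Proof. exact: rmorph0. Qed.

Lemma tspecD tau P Q : tspec tau (P + Q) = tspec tau P + tspec tau Q.
Proof. exact: rmorphD. Qed.

Lemma tspecB tau P Q : tspec tau (P - Q) = tspec tau P - tspec tau Q.
Proof. exact: rmorphB. Qed.

Lemma tspecM tau P Q : tspec tau (P * Q) = tspec tau P * tspec tau Q.
Proof. exact: rmorphM. Qed.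

Lemma tspecX tau : tspec tau 'X = 'X.
Proof. exact: map_polyX. Qed.

Lemma tspecC tau (c : {poly R}) : tspec tau c%:P = (c.[tau])%:P.
Proof. exact: map_polyC. Qed.

Lemma poly_nneg_eq0 (p : {poly R}) : (forall tau, 0 <= tau -> p.[tau] = 0) -> p = 0.
Proof.
move=> p0; apply/eqP; apply: contraT => pn0.
have := @max_poly_roots _ p [seq i%:R | i <- iota 0 (size p)] pn0.
rewrite size_map size_iota ltnn => -> //.
  by apply/allP => x /mapP[i _ ->]; rewrite rootE p0.
rewrite map_inj_uniq ?iota_uniq // => i k /eqP.
by rewrite eqr_nat => /eqP.
Qed.

Lemma tspec_eq0 (P : {poly {poly R}}) :
  (forall tau, 0 <= tau -> tspec tau P = 0) -> P = 0.
Proof.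
move=> P0; apply/polyP => i; rewrite coef0; apply: poly_nneg_eq0 => tau /P0 e.
by have := coef_map (horner_eval tau) P i; rewrite -/(tspec tau P) e coef0.
Qed.

(** The sign b is that of the leading coefficient. A signed bound, rather than one on the absolute
    value, is what passes to Abel means. *)
Lemma poly_away_from0 (p : {poly R}) (x : nat -> R) : p != 0 -> x @ \oo --> +oo ->
  exists (b : bool) (e : R), 0 < e /\ \forall n \near \oo, e <= (-1) ^+ b * p.[x n].
Proof.
move=> + /cvgryPge xy; elim/poly_ind: p => [|p c IH]; first by rewrite eqxx.
have [-> |p0 _] := eqVneq p 0.
  rewrite mul0r add0r polyC_eq0 => c0.
  exists (c < 0), `|c|; split; first by rewrite normr_gt0.
  by near=> n; rewrite hornerC mulr_sign; case: ltrP => [/ltr0_norm ->|/ger0_norm ->].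
have [b [e [e0 He]]] := IH p0; exists b, 1; split => //.
near=> n.
have ep : e <= (-1) ^+ b * p.[x n] by near: n.
(* From here on e x_n exceeds |c| by at least 1, which gives the bound 1 chosen as witness. *)
have xn : (1 + `|c|) / e <= x n by near: n; apply: xy.
have x0 : 0 <= x n by apply: le_trans xn; rewrite divr_ge0 ?addr_ge0 // ltW.
rewrite hornerD hornerM hornerX hornerC mulrDr mulrA.
have : 1 + `|c| <= (-1) ^+ b * p.[x n] * x n.
  rewrite ler_pdivrMr // in xn; apply: (le_trans xn); rewrite mulrC.
  by apply: ler_wpM2r.
have : - `|c| <= (-1) ^+ b * c.
  by rewrite lerNl -mulrN; apply: (le_trans (ler_norm _));
    rewrite normrM normrX normrN1 expr1n mul1r normrN.
lra.
Unshelve. all: by end_near. Qed.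

Lemma poly_lim0_eq0 (p : {poly R}) (x : nat -> R) : x @ \oo --> +oo ->
  (fun n => p.[x n]) @ \oo --> 0 -> p = 0.
Proof.
move=> xy pc; apply/eqP; apply: contraT => /poly_away_from0/(_ xy) [b [e [e0 He]]].
have c : (fun n => (-1) ^+ b * p.[x n]) @ \oo --> ((-1) ^+ b * 0 : R).
  by apply: cvgM => //; exact: cvg_cst.
have le : e <= (-1) ^+ b * 0 by apply: (cvgr_to_ge c).
by rewrite mulr0 leNgt e0 in le.
Qed.

Lemma cvg0_mul_poly (d x : nat -> R) (p : {poly R}) :
  (forall j, (fun n => d n * x n ^+ j) @ \oo --> 0) ->
  (fun n => d n * p.[x n]) @ \oo --> 0.
Proof.
elim/poly_ind: p d => [|p c IH] d Hd.
  by under eq_fun do rewrite horner0 mulr0; exact: cvg_cst.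
have -> : (fun n => d n * (p * 'X + c%:P).[x n]) =
    (fun n => (d n * x n) * p.[x n] + c * (d n * x n ^+ 0)).
  by apply/funext => n; rewrite hornerD hornerM hornerX hornerC expr0; ring.
rewrite -[0]addr0; apply: cvgD.
  apply: IH => j; under eq_fun do rewrite -mulrA -exprS; exact: Hd.
by rewrite -[0](mulr0 c); apply: cvgM => //; exact: cvg_cst.
Qed.

(** Rates are established against powers of [hlog] but used against powers of S_y and L_y. *)
Lemma cvg0_gauge (d x h : nat -> R) (C : R) j :
  (forall n, `|x n| <= C * h n) ->
  (fun n => d n * h n ^+ j) @ \oo --> 0 -> (fun n => d n * x n ^+ j) @ \oo --> 0.
Proof.
move=> xh c; apply: norm_cvg0.
have c' : (fun n => `|C ^+ j * (d n * h n ^+ j)|) @ \oo --> (0 : R).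
  rewrite -(normr0 R) -(mulr0 (C ^+ j)); apply: cvg_norm.
  by apply: cvgM => //; exact: cvg_cst.
apply: (squeeze_cvgr _ (cvg_cst 0) c'); near=> n.
rewrite normr_ge0 /= mulrCA -exprMn !normrM; apply: ler_wpM2l => //.
rewrite !normrX; apply: lerXn2r; rewrite ?nnegrE //.
exact: le_trans (xh n) (ler_norm _).
Unshelve. all: by end_near. Qed.

End Specialization.

Section Regularization.
Variables (R : realType) (prod : ht -> ht -> ht) (Z : ht -> {poly {poly R}}).
Hypothesis Z_reg : regularization prod Z.

Lemma reg_zero : Z 0 = 0.
Proof.
have h0 : in_h1 0 by rewrite in_h1P; apply: (wspan_lin _).1.
have := reg_linear Z_reg 1 h0 h0; rewrite scale1r addr0 /tcoef rmorph1 mul1r.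
by move/(congr1 (fun x => x - Z 0)); rewrite subrr addrK => <-.
Qed.

Lemma reg_sub f g : in_h1 f -> in_h1 g -> Z (f - g) = Z f - Z g.
Proof.
move=> hf hg; rewrite -scaleN1r addrC (reg_linear Z_reg) // /tcoef rmorphN1.
by rewrite polyCN mulN1r addrC.
Qed.

Variable tau : R.

(* phi stands for truncated sums (as n grows) or for polylogarithms at zpt n; both are
   polynomials in phi y, with coefficients converging faster than any power of phi y
   grows, and Z records the limits of these coefficients. *)
Variable phi : word -> nat -> R.
Let phil f n := wlin (cevr tau) (phi^~ n) f.
Hypothesis phi_h0 : forall w, h0word w -> forall j,
  (fun n => ((mzvt R (index_of w)).[tau] - phi w n) * phi [:: Ly] n ^+ j) @ \oo --> 0.
Hypothesis phi_ly : forall f n, in_h1 f -> phil (prod ly f) n = phi [:: Ly] n * phil f n.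
Hypothesis prod_h1 : forall f g, in_h1 f -> in_h1 g -> in_h1 (prod f g).
Hypothesis prod_tri : ly_triangular prod.

(** Quantified over all j because multiplication by y uses up one power: the error of [prod ly f] at
    j is that of f at j+1. *)
Let asymp (f : ht) := in_h1 f /\ forall j,
  (fun n => ((tspec tau (Z f)).[phi [:: Ly] n] - phil f n) * phi [:: Ly] n ^+ j) @ \oo --> 0.

Lemma asymp_lin : lin_closed asymp.
Proof.
have h0 : in_h1 0 by rewrite in_h1P; apply: (wspan_lin _).1.
split=> [|c f g [hf Hf] [hg Hg]].
  split=> // j; rewrite reg_zero tspec0; under eq_fun do rewrite horner0 /phil wlin0 subrr mul0r.
  exact: cvg_cst.
split=> [|j]; first by apply/in_h1P; apply: (wspan_lin h1word).2; apply/in_h1P.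
have -> : (fun n => ((tspec tau (Z (c *: f + g))).[phi [:: Ly] n] - phil (c *: f + g) n)
    * phi [:: Ly] n ^+ j) =
  (fun n => cev tau c * (((tspec tau (Z f)).[phi [:: Ly] n] - phil f n) * phi [:: Ly] n ^+ j)
    + ((tspec tau (Z g)).[phi [:: Ly] n] - phil g n) * phi [:: Ly] n ^+ j).
  apply/funext => n; rewrite (reg_linear Z_reg) // /phil wlin_linear tspecD tspecM tspecC.
  by rewrite hornerD hornerM hornerC -/(cev tau c) /=; ring.
rewrite -[0]addr0 -[X in X + _](mulr0 (cev tau c)).
by apply: cvgD => //; apply: cvgM => //; exact: cvg_cst.
Qed.

Lemma lyh1 : in_h1 ly.
Proof. by rewrite in_h1P; apply: wspan_mon. Qed.

Lemma asymp_ly f : asymp f -> asymp (prod ly f).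
Proof.
move=> [hf Hf]; split=> [|j]; first by apply: prod_h1 => //; exact: lyh1.
have -> : (fun n => ((tspec tau (Z (prod ly f))).[phi [:: Ly] n] - phil (prod ly f) n)
    * phi [:: Ly] n ^+ j) =
  (fun n => ((tspec tau (Z f)).[phi [:: Ly] n] - phil f n) * phi [:: Ly] n ^+ j.+1).
  apply/funext => n; rewrite (reg_mul Z_reg) //; last exact: lyh1.
  by rewrite (reg_y Z_reg) phi_ly // tspecM tspecX hornerM hornerX exprS; ring.
exact: Hf.
Qed.

Lemma Zt_mon w : Zt R (mon w) = mzvt R (index_of w).
Proof.
by rewrite /Zt msuppU oner_eq0 big_seq_fset1 mcoeffUU /tcoef rmorph1 mul1r.
Qed.

(** Triangularity expresses (lead v + 1) y v as y times v minus words with fewer leading y; the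
    rational coefficients allow division by lead v + 1. *)
Lemma asymp_word n w : h1word w -> (lead w <= n)%N -> asymp (mon w).
Proof.
elim: n w => [|n IH] w hw wn.
  have hw0 : h0word w by rewrite /h0word hw; case: w wn {hw} => [|[]].
  split=> [|j]; first by rewrite in_h1P; apply: wspan_mon.
  rewrite (reg_h0 Z_reg); last by rewrite in_h0P; apply: wspan_mon.
  rewrite tspecC Zt_mon; under eq_fun do rewrite hornerC /phil wlin_mon.
  exact: phi_h0.
case: w hw wn => [|[] v] hw wn; try by apply: IH.
have hv := h1word_cons hw.
have Av : asymp (mon v) by apply: IH.
have Ar : asymp (prod ly (mon v) - mon (Ly :: v) *+ (lead v).+1).
  apply: (wspan_ind asymp_lin) (prod_tri hv) => u /andP[hu uv].
  by apply: IH => //; apply: leq_trans uv _.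
have := lin_closedB asymp_lin (asymp_ly Av) Ar; rewrite subKr => A.
by have := lin_closedZ ((lead v).+1%:R^-1)%:P asymp_lin A; rewrite scale_invn_mulrn.
Qed.

Lemma asymptotics f j : in_h1 f ->
  (fun n => ((tspec tau (Z f)).[phi [:: Ly] n] - phil f n) * phi [:: Ly] n ^+ j) @ \oo --> 0.
Proof.
rewrite in_h1P => hf; suff : asymp f by case=> _; apply.
apply: (wspan_ind asymp_lin) hf => w hw; exact: (asymp_word hw (leqnn _)).
Qed.

End Regularization.

(** * Comparison of the two regularizations *)

Lemma abel_mean_cvg0 (R : realType) (s G : nat -> R) :
  (forall n, sums (fun m => s m * zpt R n ^+ m) @ \oo --> G n) ->
  s @ \oo --> 0 -> (fun n => (1 - zpt R n) * G n) @ \oo --> 0.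
Proof.
move=> sG s0; apply/cvgr0Pnorm_le => e e0.
have e2 : 0 < e / 2 by rewrite divr_gt0.
have ns : \forall m \near \oo, `|s m| <= e / 2 by exact: cvgr0_norm_le s0 _ e2.
have lo : \forall m \near \oo, - (e / 2) <= s m.
  by apply: filterS ns => m; rewrite ler_norml => /andP[].
have up : \forall m \near \oo, - (e / 2) <= - s m.
  by apply: filterS ns => m; rewrite ler_norml lerN2 => /andP[].
have sGN n : sums (fun m => - s m * zpt R n ^+ m) @ \oo --> - G n.
  have -> : sums (fun m => - s m * zpt R n ^+ m) =
      (fun N => - sums (fun m => s m * zpt R n ^+ m) N).
    by apply/funext => N; rewrite /sums -sumrN; apply: eq_bigr => i _; rewrite mulNr.
  exact: cvgN.
have A := abel_mean_ge sG lo e2; have B := abel_mean_ge sGN up e2.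
near=> n; rewrite ler_norml.
have An : - (e / 2) - e / 2 <= (1 - zpt R n) * G n by near: n.
have Bn : - (e / 2) - e / 2 <= (1 - zpt R n) * - G n by near: n.
rewrite mulrN in Bn.
have half : - (e / 2) - e / 2 = - e by lra.
by rewrite half in An Bn; rewrite An -lerN2.
Unshelve. all: by end_near. Qed.

Section DoubleShuffle.
Variables (R : realType) (Zsh Zst : ht -> {poly {poly R}}).
Hypothesis Zsh_reg : regularization tshuffle Zsh.
Hypothesis Zst_reg : regularization tharmonic Zst.

Section Tau.
Variable tau : R.
Hypothesis tau0 : 0 <= tau.
Notation ssum := (@ssum R tau).
Notation ssuml := (@ssuml R tau).
Notation polylog := (@polylog R tau).
Notation polylogl := (@polylogl R tau).

Lemma ssum_y n : ssum [:: Ly] n = hlog R n - 1.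
Proof. by rewrite -sum_invn; apply: eq_bigr => i _; rewrite acoef_y. Qed.

Lemma ssum_y_cvgy : ssum [:: Ly] @ \oo --> +oo.
Proof.
apply/cvgryPge => A; have /cvgryPge/(_ (A + 1)) := @hlog_cvgy R.
by apply: filterS => n; rewrite ssum_y lerBrDr.
Qed.

Lemma polylog_y_cvgy : polylog [:: Ly] @ \oo --> +oo.
Proof.
apply/cvgryPge => A; have /cvgryPge/(_ (A + 2)) := @hlog_cvgy R.
apply: filterS => n An; have /andP[le _] := polylog_y_bounds tau0 n.
by apply: le_trans le; rewrite lerBrDr.
Qed.

Lemma harmonic_asymptotics f j : in_h1 f ->
  (fun n => ((tspec tau (Zst f)).[ssum [:: Ly] n] - ssuml f n) * ssum [:: Ly] n ^+ j)
    @ \oo --> 0.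
Proof.
apply: (asymptotics Zst_reg) => [w hw i|g n hg||].
- apply: (@cvg0_gauge _ _ _ (hlog R) 1); last exact: ssum_h0_rate.
  by move=> n; rewrite mul1r ssum_y ger0_norm ?lerBlDr ?lerDl // subr_ge0 hlog_ge1.
- rewrite -[LHS]/(ssuml _ _) ssuml_tharmonic //; last exact: lyh1.
  by rewrite ssuml_mon.
- exact: tharmonic_h1.
- exact: tharmonic_triangular.
Qed.

Lemma shuffle_asymptotics f : in_h1 f ->
  (fun n => (tspec tau (Zsh f)).[polylog [:: Ly] n] - polylogl f n) @ \oo --> 0.
Proof.
move=> hf; have -> : (fun n => (tspec tau (Zsh f)).[polylog [:: Ly] n] - polylogl f n) =
  (fun n => ((tspec tau (Zsh f)).[polylog [:: Ly] n] - polylogl f n) * polylog [:: Ly] n ^+ 0).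
  by apply/funext => n; rewrite expr0 mulr1.
apply: (asymptotics Zsh_reg) hf => [w hw i|g n hg||].
- apply: (@cvg0_gauge _ _ _ (hlog R) 2); last exact: polylog_h0_rate.
  move=> n; have /andP[lo up] := polylog_y_bounds tau0 n.
  have h1 := hlog_ge1 R n; rewrite ler_norml; apply/andP; split; lra.
- exact: polylogl_ly_tshuffle.
- exact: tshuffle_h1.
- exact: tshuffle_triangular.
Qed.

(** The defect is d S_{w1} with d = Z_t(w0) - S_{w0}. As S_{w1} may be unbounded, it is replaced by
    a polynomial in S_y up to o(1), and d beats every power of S_y. *)
Lemma ssuml_defect_cvg0 w1 w0 : in_h1 w1 -> in_h0 w0 ->
  (fun n => (Zt R w0).[tau] * ssuml w1 n - ssuml (tharmonic w1 w0) n) @ \oo --> 0.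
Proof.
move=> h1 h0; have h01 := in_h0_h1 h0.
pose d n := (Zt R w0).[tau] - ssuml w0 n.
have d0 j : (fun n => d n * ssum [:: Ly] n ^+ j) @ \oo --> 0.
  have := harmonic_asymptotics j h01; rewrite (reg_h0 Zst_reg h0) tspecC.
  by under eq_fun do rewrite hornerC.
have dd : d @ \oo --> 0.
  by have := d0 0%N; under eq_fun do rewrite expr0 mulr1.
have e1 : (fun n => (tspec tau (Zst w1)).[ssum [:: Ly] n] - ssuml w1 n) @ \oo --> 0.
  by have := harmonic_asymptotics 0 h1; under eq_fun do rewrite expr0 mulr1.
have -> : (fun n => (Zt R w0).[tau] * ssuml w1 n - ssuml (tharmonic w1 w0) n) =
  (fun n => d n * (tspec tau (Zst w1)).[ssum [:: Ly] n] -
    d n * ((tspec tau (Zst w1)).[ssum [:: Ly] n] - ssuml w1 n)).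
  by apply/funext => n; rewrite ssuml_tharmonic // /d; ring.
rewrite -[0](subrr 0); apply: cvgB; first exact: cvg0_mul_poly.
by rewrite -[0](mulr0 0); apply: cvgM.
Qed.

Lemma tspec_Zsh_tharmonic w1 w0 : in_h1 w1 -> in_h0 w0 ->
  tspec tau (Zsh (tshuffle w1 w0 - tharmonic w1 w0)) = 0.
Proof.
move=> h1 h0; have h01 := in_h0_h1 h0.
have hst := tharmonic_h1 h1 h01; have hsh := tshuffle_h1 h1 h01.
rewrite (reg_sub Zsh_reg hsh hst).
rewrite [X in tspec _ (X - _)](reg_mul Zsh_reg h1 h01).
rewrite [Zsh w0](reg_h0 Zsh_reg h0).
rewrite tspecB tspecM tspecC; apply: (poly_lim0_eq0 polylog_y_cvgy).
set c := (Zt R w0).[tau].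
have A := shuffle_asymptotics h1; have B := shuffle_asymptotics hst.
have C : (fun n => c * polylogl w1 n - polylogl (tharmonic w1 w0) n) @ \oo --> 0.
  have sG n : sums (fun m => (c * ssuml w1 m - ssuml (tharmonic w1 w0) m) * zpt R n ^+ m)
      @ \oo --> (c * polylogl w1 n - polylogl (tharmonic w1 w0) n) * (1 - zpt R n)^-1.
    have -> : sums (fun m => (c * ssuml w1 m - ssuml (tharmonic w1 w0) m) * zpt R n ^+ m) =
        (fun N => c * sums (fun m => ssuml w1 m * zpt R n ^+ m) N -
          sums (fun m => ssuml (tharmonic w1 w0) m * zpt R n ^+ m) N).
      apply/funext => N; rewrite /sums mulr_sumr -sumrB; apply: eq_bigr => i _.
      by rewrite mulrBl mulrA.
    rewrite mulrBl -mulrA; apply: cvgB; last exact: ssuml_cvg.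
    by apply: cvgM; [exact: cvg_cst|exact: ssuml_cvg].
  have := abel_mean_cvg0 sG (ssuml_defect_cvg0 h1 h0).
  under eq_fun => n do rewrite mulrCA divff ?mulr1 ?sub1_zpt ?invr_eq0 ?pnatr_eq0 //.
  by [].
have -> : (fun n => (tspec tau (Zsh w1) * c%:P - tspec tau (Zsh (tharmonic w1 w0))).[polylog [:: Ly] n]) =
  (fun n => ((tspec tau (Zsh w1)).[polylog [:: Ly] n] - polylogl w1 n) * c
   - ((tspec tau (Zsh (tharmonic w1 w0))).[polylog [:: Ly] n] - polylogl (tharmonic w1 w0) n)
   + (c * polylogl w1 n - polylogl (tharmonic w1 w0) n)).
  by apply/funext => n; rewrite hornerD hornerN hornerM hornerC; ring.
rewrite -[0]addr0; apply: cvgD => //; rewrite -[0](subrr 0); apply: cvgB => //.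
by rewrite -[0](mul0r c); apply: cvgM => //; exact: cvg_cst.
Qed.

Lemma tspec_Zst_eq0 g : in_h1 g -> tspec tau (Zsh g) = 0 -> tspec tau (Zst g) = 0.
Proof.
move=> hg Z0; apply/eqP; apply: contraT => Zn0.
have [b [e [e0 He]]] := poly_away_from0 Zn0 ssum_y_cvgy.
have e1 : (fun n => (tspec tau (Zst g)).[ssum [:: Ly] n] - ssuml g n) @ \oo --> 0.
  by have := harmonic_asymptotics 0 hg; under eq_fun do rewrite expr0 mulr1.
have L0 : polylogl g @ \oo --> 0.
  have -> : polylogl g =
      (fun n => - ((tspec tau (Zsh g)).[polylog [:: Ly] n] - polylogl g n)).
    by apply/funext => n; rewrite Z0 horner0 sub0r opprK.
  by rewrite -[0]oppr0; apply: cvgN; exact: shuffle_asymptotics.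
(* One quarter of e pays for the error of the asymptotics and another for the Abel mean, so that e /
   2 is left in the limit. *)
have e4 : 0 < e / 4 by rewrite divr_gt0.
have Hs : \forall m \near \oo, 3 * (e / 4) <= (-1) ^+ b * ssuml g m.
  have n1 : \forall m \near \oo,
      `|(tspec tau (Zst g)).[ssum [:: Ly] m] - ssuml g m| <= e / 4.
    exact: cvgr0_norm_le e1 _ e4.
  near=> m; have n1m : `|(tspec tau (Zst g)).[ssum [:: Ly] m] - ssuml g m| <= e / 4 by near: m.
  have He' : e <= (-1) ^+ b * (tspec tau (Zst g)).[ssum [:: Ly] m] by near: m.
  move: He' n1m; rewrite ler_norml => He' /andP[l u].
  case: (b) He' => /=; rewrite ?expr1 ?expr0; lra.
have sG n : sums (fun m => ((-1) ^+ b * ssuml g m) * zpt R n ^+ m) @ \oo -->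
    (-1) ^+ b * (polylogl g n * (1 - zpt R n)^-1).
  have -> : sums (fun m => ((-1) ^+ b * ssuml g m) * zpt R n ^+ m) =
      (fun N => (-1) ^+ b * sums (fun m => ssuml g m * zpt R n ^+ m) N).
    by apply/funext => N; rewrite /sums mulr_sumr; apply: eq_bigr => i _; rewrite mulrA.
  by apply: cvgM; [exact: cvg_cst|exact: ssuml_cvg].
have A := abel_mean_ge sG Hs e4.
have c : (fun n => (-1) ^+ b * polylogl g n) @ \oo --> ((-1) ^+ b * 0 : R).
  by apply: cvgM => //; exact: cvg_cst.
have le : 3 * (e / 4) - e / 4 <= (-1) ^+ b * 0.
  apply: (cvgr_to_ge c); apply: filterS A => n.
  have z0 : 1 - zpt R n != 0 by rewrite sub1_zpt invr_eq0 pnatr_eq0.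
  by rewrite [polylogl g n / _]mulrC [(-1) ^+ b * (_ * _)]mulrCA mulVKf.
have pos : 0 < 3 * (e / 4) - e / 4 by lra.
by rewrite mulr0 leNgt pos in le.
Unshelve. all: by end_near. Qed.

End Tau.

Lemma Zsh_double_shuffle w1 w0 : in_h1 w1 -> in_h0 w0 ->
  Zsh (tshuffle w1 w0 - tharmonic w1 w0) = 0.
Proof. by move=> h1 h0; apply: tspec_eq0 => tau tau0; apply: tspec_Zsh_tharmonic. Qed.

Lemma Zst_double_shuffle w1 w0 : in_h1 w1 -> in_h0 w0 ->
  Zst (tshuffle w1 w0 - tharmonic w1 w0) = 0.
Proof.
move=> h1 h0; have h01 := in_h0_h1 h0; apply: tspec_eq0 => tau tau0.
apply: (tspec_Zst_eq0 tau0); last exact: (tspec_Zsh_tharmonic tau0 h1 h0).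
apply/in_h1P; apply: (lin_closedB (wspan_lin _)); apply/in_h1P.
  exact: tshuffle_h1.
exact: tharmonic_h1.
Qed.

End DoubleShuffle.

Unset Implicit Arguments.

Theorem theorem2p8 (R : realType) (Zsh Zst : ht -> {poly {poly R}})
  (Zsh_reg : regularization tshuffle Zsh)
  (Zst_reg : regularization tharmonic Zst)
  (w1 w0 : ht) (w1_h1 : in_h1 w1) (w0_h0 : in_h0 w0) :
  Zsh (tshuffle w1 w0 - tharmonic w1 w0) = 0 /\
  Zst (tshuffle w1 w0 - tharmonic w1 w0) = 0.
Proof.
split.
  exact: (Zsh_double_shuffle Zsh_reg Zst_reg w1_h1 w0_h0).
exact: (Zst_double_shuffle Zsh_reg Zst_reg w1_h1 w0_h0).
Qed.
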